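(* Let $f:X\to\mathbb{R}$ be a Walters's summable potential with associated sequences and limits $a_n\to a$, $b_n\to b$, $c_n\to c$, $d_n\to d$, such that $a=c=0$, $b_n=b$ for all $n\ge1$, $d_n=d$ for all $n\ge1$, and such that the numbers $b$, $d$, $a_n$, $c_n$ ($n\ge2$) are all strictly smaller than zero. If $$\sum_{j=2}^\infty a_j<b+d+\sum_{j=2}^\infty c_j,$$ then $\mu_t\to\delta_{1^\infty}$ in the weak* topology as $t\to\infty$. Also, $\frac{\mu_t([0])}{\mu_t([1])}\to0$ exponentially fast as $t\to\infty$, i.e. $\limsup_{t\to\infty}\frac1t\log\frac{\mu_t([0])}{\mu_t([1])}<0$.
   Context: $X=\{0,1\}^{\mathbb N}$ with the product topology, $\sigma$ is the left shift on $X$, $\mathcal M$ is the set of $\sigma$-invariant Borel probability measures on $X$. For $n\ge1$, $0^n$ and $1^n$ are the words of $n$ consecutive $0$'s, respectively $1$'s; $0^\infty,1^\infty$ are the constant sequences. For a finite word $w$, $[w]$ is the cylinder of points of $X$ beginning with $w$. The class $R(X)$: $f:X\to\mathbb R$ is in $R(X)$ if there are real sequences $(a_n)_{n\ge2}\to a$, $(b_n)_{n\ge1}\to b$, $(c_n)_{n\ge2}\to c$, $(d_n)_{n\ge1}\to d$ such that for all $z\in X$, $p\ge2$, $q\ge1$: $f(0^p1z)=a_p$, $f(01^q0z)=b_q$, $f(1^p0z)=c_p$, $f(10^q1z)=d_q$, and $f(0^\infty)=a$, $f(01^\infty)=b$, $f(1^\infty)=c$, $f(10^\infty)=d$. A Walters's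 summable potential is $f\in R(X)$ such that the series $\sum_{n\ge2}(a_n-a)$ and $\sum_{n\ge2}(c_n-c)$ converge. For $t>0$ the Ruelle operator on continuous functions is $L_{tf}(w)(x)=\sum_{\sigma(y)=x}e^{tf(y)}w(y)$, and $P(tf)=\sup_{\rho\in\mathcal M}\big(h(\rho)+t\int f\,d\rho\big)$, where $h(\rho)$ is the Kolmogorov entropy. It is known (Walters) that there are a strictly positive continuous function $h_t$ with $L_{tf}h_t=e^{P(tf)}h_t$ and a positive finite Borel measure $\nu_t$ with $L_{tf}^*\nu_t=e^{P(tf)}\nu_t$; they are normalized by $h_t(0^\infty)=1$ and $\int h_t\,d\nu_t=1$. The Gibbs state of $tf$ is the probability $\mu_t=h_t\nu_t\in\mathcal M$. *)

(* Defs.v *)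
From HB Require Import structures.
From mathcomp Require Export all_boot all_order all_algebra.
From mathcomp Require Export all_classical all_reals all_analysis.

Set Implicit Arguments.
Unset Strict Implicit.
Unset Printing Implicit Defensive.

Export Order.TTheory GRing.Theory Num.Theory.
Export numFieldNormedType.Exports.

Local Open Scope classical_set_scope.
Local Open Scope ring_scope.

(* {0,1}^N, with false for 0 and true for 1, the product topology and the
   Borel sigma-algebra. *)
Definition full_shift : Type := cantor_space.

HB.instance Definition _ := Uniform.on full_shift.
HB.instance Definition _ := Pointed.on full_shift.
HB.instance Definition _ :=
  @isMeasurable.Build (sigma_display (@open full_shift)) full_shift
    <<s @open full_shift >> (@sigma_algebra0 _ setT (@open full_shift))
    (@sigma_algebraC _ (@open full_shift))
    (@sigma_algebra_bigcup _ setT (@open full_shift)).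

Definition shift (x : full_shift) : full_shift := fun n => x n.+1.

Definition prepend (w : seq bool) (z : full_shift) : full_shift :=
  fun n => if (n < size w)%N then nth false w n else z (n - size w)%N.

Definition const_seq (i : bool) : full_shift := fun=> i.

Definition cylinder (w : seq bool) : set full_shift :=
  [set x | forall i, (i < size w)%N -> x i = nth false w i].

(* f belongs to the class R(X) with associated sequences a, b, c, d and limits
   la, lb, lc, ld; the values a 0, a 1, b 0, c 0, c 1, d 0 are irrelevant. *)
Definition RX (R : realType) (f : full_shift -> R)
    (a : R^nat) (la : R) (b : R^nat) (lb : R)
    (c : R^nat) (lc : R) (d : R^nat) (ld : R) : Prop :=
  [/\ [/\ a @ \oo --> la, b @ \oo --> lb, c @ \oo --> lc & d @ \oo --> ld],
      forall z p, (2 <= p)%N ->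
        f (prepend (rcons (nseq p false) true) z) = a p /\
        f (prepend (rcons (nseq p true) false) z) = c p,
      forall z q, (1 <= q)%N ->
        f (prepend (false :: rcons (nseq q true) false) z) = b q /\
        f (prepend (true :: rcons (nseq q false) true) z) = d q &
      [/\ f (const_seq false) = la,
          f (prepend [:: false] (const_seq true)) = lb,
          f (const_seq true) = lc &
          f (prepend [:: true] (const_seq false)) = ld]].

Definition walters_summable (R : realType) (f : full_shift -> R)
    (a : R^nat) (la : R) (b : R^nat) (lb : R)
    (c : R^nat) (lc : R) (d : R^nat) (ld : R) : Prop :=
  [/\ RX f a la b lb c lc d ld,
      cvgn (fun N => \sum_(2 <= n < N) (a n - la)) &
      cvgn (fun N => \sum_(2 <= n < N) (c n - lc))].

Definition invariant_probability (R : realType) :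
    set (probability full_shift R) :=
  [set rho | forall A, measurable A -> rho (shift @^-1` A) = rho A].

(* Shannon entropy of the join of xi, shift^-1 xi, ..., shift^-(n-1) xi; its
   atoms are indexed by the words w, those indexing an empty intersection
   contributing 0 (ln 0 = 0, and the factor rho(set0) vanishes anyway). *)
Definition join_entropy (R : realType) (rho : probability full_shift R)
    (k : nat) (xi : 'I_k -> set full_shift) (n : nat) : R :=
  - \sum_(w : {ffun 'I_n -> 'I_k})
      let p := fine (rho (\bigcap_i (iter (i : 'I_n) shift @^-1` xi (w i)))) in
      p * ln p.

Definition partition_entropy (R : realType) (rho : probability full_shift R)
    (k : nat) (xi : 'I_k -> set full_shift) : R :=
  limn (fun n => n%:R^-1 * join_entropy rho xi n).

Definition measurable_partition (k : nat) (xi : 'I_k -> set full_shift) :=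
  (forall i, measurable (xi i)) /\ partition [set: 'I_k] xi [set: full_shift].

Definition entropy (R : realType) (rho : probability full_shift R) : \bar R :=
  ereal_sup [set s | exists k (xi : 'I_k -> set full_shift),
    measurable_partition xi /\ s = (partition_entropy rho xi)%:E].

Definition pressure (R : realType) (f : full_shift -> R) (t : R) : \bar R :=
  ereal_sup [set (entropy rho + (t * \int[rho]_x f x)%:E)%E
            | rho in @invariant_probability R].

Definition ruelle (R : realType) (f : full_shift -> R) (t : R)
    (w : full_shift -> R) (x : full_shift) : R :=
  \sum_(y \in [set y | shift y = x]) expR (t * f y) * w y.

(* The entropy of every shift-invariant probability is at most ln 2 and f is
   bounded in the intended use, so that the pressure is finite. *)
Definition ruelle_eigenvalue (R : realType) (f : full_shift -> R) (t : R) : R :=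
  expR (fine (pressure f t)).

(* The eigenmeasure equation is tested against continuous functions, i.e. the
   adjoint of ruelle f t acts on the dual of C({0,1}^N). *)
Definition gibbs_state (R : realType) (f : full_shift -> R) (t : R)
    (mu : probability full_shift R) : Prop :=
  exists (h : full_shift -> R) (nu : {finite_measure set full_shift -> \bar R}),
    [/\ [/\ continuous h, (forall x, 0 < h x) &
            forall x, ruelle f t h x = ruelle_eigenvalue f t * h x],
        forall w : full_shift -> R, continuous w ->
          \int[nu]_x ruelle f t w x = ruelle_eigenvalue f t * \int[nu]_x w x,
        h (const_seq false) = 1,
        \int[nu]_x h x = 1 &
        forall A, measurable A -> mu A = (\int[nu]_(x in A) (h x)%:E)%E].

Definition weak_star_cvg (R : realType)
    (mu : R -> probability full_shift R) (m : probability full_shift R) : Prop :=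
  forall g : full_shift -> R, continuous g ->
    \int[mu t]_x g x @[t --> +oo] --> \int[m]_x g x.

(* Main.v *)
Require Import Defs.
From mathcomp Require Import ring lra.

(* The eigenfunction equation at the fixed point 0^oo, where f vanishes, already
   gives lambda > 1, so the variational definition of the pressure plays no
   role.  Decompose [i] into the cylinders [i^p j], with j <> i and p >= 1.  The
   eigenmeasure equation gives nu[i^p j] = lambda^-p exp(t(g_i + S_i(p))) nu[j],
   where S_0(p), S_1(p) are the partial sums of (a_n), (c_n) and (g_0, g_1) =
   (b, d).  Hence with A_i = sum_p lambda^-p exp(t S_i(p)) one has
   exp(t(b+d)) A_0 A_1 = 1, which makes h constant on every [i^p j] and yields
     mu[i] = K_i sum_p p lambda^-p exp(t S_i(p)),
   with K_0/K_1 <= lambda^2 exp(-t(b+d)).  Let S_i be the limit of S_i(p).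
   From A_i >= exp(t S_i)/(lambda-1) and
   A_i <= k + exp(t(S_i+delta))/(lambda-1) for some k depending only on delta,
   the relation A_0 A_1 = exp(-t(b+d)) together with S_0 < b+d+S_1 forces
   lambda - 1 to be exp(t(S_1+b+d)) up to factors exp(O(delta t)), and then
   mu[0]/mu[1] decays like the larger of exp(t(S_1+b+d)) and
   exp(t(S_0-S_1-b-d)), again up to factors exp(O(delta t)). *)

Set Implicit Arguments.
Unset Strict Implicit.
Unset Printing Implicit Defensive.

Local Open Scope classical_set_scope.
Local Open Scope ring_scope.

(** * Topology of the full shift *)

Definition agree (n : nat) (x y : full_shift) : Prop :=
  forall i, (i < n)%N -> x i = y i.

Lemma nbhs_agree (n : nat) (x : full_shift) : nbhs x [set y | agree n x y].
Proof.
elim: n => [|n IHn]; first exact: filterS filterT.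
have px : nbhs x [set y : full_shift | x n = y n].
  have : nbhs (x n) [set b | x n = b].
    by rewrite nbhs_principalE; exact/principal_filterP.
  exact: (@proj_continuous _ (fun _ : nat => bool) n x).
apply: filterS (filterI IHn px) => y [/= xy xyn] i.
by rewrite ltnS leq_eqVlt => /predU1P[->//|]; exact: xy.
Qed.

(** Otherwise some points outside [A] agree with [x] to every depth [n]; they converge to [x]
    coordinatewise, hence in the product topology. *)
Lemma nbhs_agree_sub (x : full_shift) (A : set full_shift) :
  nbhs x A -> exists n, [set y | agree n x y] `<=` A.
Proof.
move=> xA; apply: contrapT => /forallNP noA.
have /choice[y yP] : forall n, exists y, agree n x y /\ ~ A y.
  move=> n; apply: contrapT => /forallNP ny; apply: (noA n) => y /= xy.
  by apply: contrapT => nAy; exact: (ny y).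
have : y @ \oo --> x.
  apply/cvg_sup => i U [V [[W oW <-] Wx]] /filterS; apply => /=.
  exists i.+1 => // n /= lt_in; rewrite /preimage /=.
  by have [<- ] := yP n.
by move=> /(_ _ xA)[n _ /(_ n (leqnn n))]; have [] := yP n.
Qed.

Section continuity.
Variable R : realType.
Implicit Type w : full_shift -> R.

Lemma locally_constant_continuous w (n : nat) :
  (forall x y, agree n x y -> w x = w y) -> continuous w.
Proof.
move=> wn x; apply: cvg_near_cst.
by apply: filterS (nbhs_agree n x) => y /= /wn ->.
Qed.

(** Uniform continuity by compactness: a sequence of bad pairs has a cluster point [p], and both
    members of some late pair have values within [e / 2] of [w p]. *)
Lemma continuous_agree w : continuous w -> forall e : R, 0 < e ->
  exists n, forall x y, agree n x y -> `|w x - w y| < e.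
Proof.
move=> cw e e0; apply: contrapT => /forallNP now.
have /choice[x xP] :
    forall n, exists x, exists y, agree n x y /\ e <= `|w x - w y|.
  move=> n; apply: contrapT => /forallNP nx; apply: (now n) => x y xy.
  by rewrite ltNge; apply/negP => exy; apply: (nx x); exists y.
have [p [_ clp]] := @cantor_space_compact (x @ \oo) _ filterT.
have [n pn] : exists n, [set y | agree n p y] `<=` [set y | `|w p - w y| < e / 2].
  apply: nbhs_agree_sub; have /cvgrPdist_lt := cw p.
  by apply; rewrite divr_gt0.
have [_ /= [[m nm <-] pxm]] :
    [set x m | m in [set m | (n <= m)%N]] `&` [set y | agree n p y] !=set0.
  by apply: clp; [exists n => // m /= nm; exists m|exact: nbhs_agree].
have [y [xy]] := xP m; apply/negP; rewrite -ltNge.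
have pym : agree n p y by move=> i ni; rewrite pxm// xy// (leq_trans ni).
have /= xd := pn _ pxm; have /= yd := pn _ pym.
have -> : w (x m) - w y = (w p - w y) - (w p - w (x m)) by ring.
by rewrite (le_lt_trans (ler_normB _ _))// (splitr e) ltrD.
Qed.

Lemma agree_continuous w :
  (forall e : R, 0 < e -> exists n, forall x y, agree n x y -> `|w x - w y| < e) ->
  continuous w.
Proof.
move=> wn x; apply/cvgrPdist_lt => e /wn[n xyn].
by apply: filterS (nbhs_agree n x) => y /=; exact: xyn.
Qed.

Lemma continuous_bounded w : continuous w ->
  exists2 M, 0 < M & forall x, `|w x| <= M.
Proof.
move=> cw.
have cT : compact [set: full_shift] by exact: cantor_space_compact.
have /compact_bounded[M [_ wM]] : compact (range w).
  by apply: continuous_compact => //; exact: continuous_subspaceT.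
exists (`|M| + 1) => [|x]; first by rewrite ltr_pwDr.
by apply: wM => //; rewrite ltr_pwDr// ler_norm.
Qed.

Lemma continuous_measurable w : continuous w -> measurable_fun setT w.
Proof.
move=> /continuousP cw.
apply: (measurability _ (measurable_realfun.RGenOpens.measurableE R)).
move=> _ [_ [a [b ->] <-]]; rewrite setTI; apply: sub_sigma_algebra.
exact/cw/interval_open.
Qed.

Lemma continuous_integrable (nu : {finite_measure set full_shift -> \bar R}) w :
  continuous w -> nu.-integrable setT (EFin \o w).
Proof.
move=> cw; apply: measurable_bounded_integrable => //.
- exact: fin_num_fun_lty.
- exact: continuous_measurable.
- have [M _ wM] := continuous_bounded cw.
  exists M; split=> [|y My x _]; first exact: num_real.
  exact: le_trans (wM x) (ltW My).
Qed.

End continuity.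

(** * Renewal estimates *)

(** Disposes of the errors made by truncating at [P] the sums over run lengths. *)
Lemma le_of_geometric (R : realType) (x y B r : R) : 0 <= r < 1 ->
  (forall P : nat, x <= y + B * r ^+ P) -> x <= y.
Proof.
move=> /andP[r0 r1] xy.
have cv : (fun P : nat => y + B * r ^+ P) @ \oo --> y + B * 0.
  by apply: cvgD; [exact: cvg_cst|apply: cvgMr; apply: cvg_expr; rewrite ger0_norm].
rewrite mulr0 addr0 in cv; rewrite -(cvg_lim _ cv)//.
by apply: limr_ge; [apply/cvg_ex; exists y|exact: nearW].
Qed.

(** The difference [u - v] is nondecreasing and bounded above by a null sequence, so it is never
    positive. *)
Lemma le_of_decrements (R : realType) (r B : R) (u v : nat -> R) : 0 <= r < 1 ->
  (forall p, u p - v p <= B * r ^+ p) ->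
  (forall p, u p - u p.+1 <= v p - v p.+1) -> forall p, u p <= v p.
Proof.
move=> r01 uvB duv p; apply: (@le_of_geometric _ _ _ (B * r ^+ p) r) => // P.
have uvP : u p - v p <= u (p + P)%N - v (p + P)%N.
  elim: P => [|P IH]; first by rewrite addn0.
  by apply: le_trans IH _; rewrite addnS; have := duv (p + P)%N; lra.
have := uvB (p + P)%N; rewrite exprD mulrA; lra.
Qed.

Section geometric.
Variables (R : realType) (lam : R).
Hypothesis lam_gt1 : 1 < lam.
Local Notation r := lam^-1.

Let eps_gt0 : 0 < lam - 1. Proof. by rewrite subr_gt0. Qed.
Let lam_gt0 : 0 < lam. Proof. exact: lt_trans lam_gt1. Qed.

Lemma invr_itv01 : 0 <= r < 1.
Proof. by rewrite invr_ge0 ltW//= invf_lt1. Qed.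

Lemma sum_geometric P :
  \sum_(p < P) r ^+ p = lam / (lam - 1) * (1 - r ^+ P).
Proof.
elim: P => [|P IH]; first by rewrite big_ord0 expr0 subrr mulr0.
rewrite big_ord_recr/= IH exprS; field.
by rewrite !gt_eqF.
Qed.

Lemma expr_invr_itv P : 0 < r ^+ P <= 1.
Proof.
have /andP[r0 r1] := invr_itv01.
by rewrite exprn_gt0 ?invr_gt0//= exprn_ile1// ltW.
Qed.

Lemma sum_lt_nat k P : \sum_(p < P) (p < k)%:R <= k%:R :> R.
Proof.
elim: P k => [|P IH] k; first by rewrite big_ord0.
rewrite big_ord_recl; case: k => [|k].
  by rewrite big1// addr0.
rewrite (_ : k.+1%:R = 1 + k%:R :> R) ?lerD//; last by rewrite -nat1r.
exact: IH.
Qed.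

Lemma sum_subn_nat k P : \sum_(p < P) (k - p)%:R <= k%:R ^+ 2 :> R.
Proof.
apply: (@le_trans _ _ (\sum_(p < P) (p < k)%:R * k%:R)).
  apply: ler_sum => p _; case: ltnP => [pk|].
    by rewrite mul1r ler_nat leq_subr.
  by rewrite -subn_eq0 => /eqP ->; rewrite mul0r.
by rewrite -mulr_suml expr2 ler_wpM2r// sum_lt_nat.
Qed.

Variable pr : nat -> R.
(** General term of the return series A_i, where [pr p] is to be the product of the first [p]
    factors [E i j]; the index [p] corresponds to the cylinder [[i^(p+1) (~~ i)]]. *)
Definition weight p := r ^+ p.+1 * pr p.

Section upper.
Variables (k : nat) (s : R).
Hypotheses (s_ge0 : 0 <= s) (pr_le : forall p, pr p <= (p < k)%:R + s).

Lemma weight_le p : weight p <= (p < k)%:R + s * r ^+ p.+1.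
Proof.
have /andP[x0 x1] := expr_invr_itv p.+1; rewrite /weight.
apply: (le_trans (ler_wpM2l (ltW x0) (pr_le p))).
by rewrite mulrDr [s * _]mulrC lerD2r ler_piMl.
Qed.

(** The first [k] terms contribute at most 1 each beyond a geometric series of total
    [s / (lam - 1)]. *)
Lemma sum_weight_le P : \sum_(p < P) weight p <= k%:R + s / (lam - 1).
Proof.
apply: (@le_trans _ _ (\sum_(p < P) ((p < k)%:R + s * r ^+ p.+1))).
  by apply: ler_sum => p _; exact: weight_le.
rewrite big_split/= lerD ?sum_lt_nat//.
under eq_bigr do rewrite exprS mulrA.
rewrite -mulr_sumr sum_geometric.
rewrite (_ : _ * (_ * _) = s / (lam - 1) * (1 - r ^+ P)); last first.
  by field; rewrite !gt_eqF.
rewrite ler_piMr ?divr_ge0 ?(ltW eps_gt0)//.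
by rewrite gerBl; have /andP[/ltW] := expr_invr_itv P.
Qed.

(** Being bounded above by a null sequence, [m] is at most the tail sum of its decrements. The
    right-hand side is the tail sum of their upper bounds, the truncated subtraction [k - p]
    counting the indices from [p] to [k - 1]. *)
Lemma decrement_le (K B : R) (m : nat -> R) : 0 <= K ->
  (forall p, m p <= B * r ^+ p) ->
  (forall p, m p - m p.+1 = K * weight p) ->
  forall p, m p <= K * ((k - p)%:R + s / (lam - 1) * r ^+ p).
Proof.
move=> K0 mB dm.
apply: (le_of_decrements (B := B) invr_itv01) => p.
  rewrite lerBlDr (le_trans (mB p))// lerDl mulr_ge0// addr_ge0// mulr_ge0//.
    by rewrite divr_ge0// ltW.
  by have /andP[/ltW] := expr_invr_itv p.
rewrite dm -mulrBr ler_wpM2l//; apply: le_trans (weight_le p) _.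
have -> : (p < k)%:R = (k - p)%:R - (k - p.+1)%:R :> R.
  case: (ltnP p k) => pk.
    rewrite -natrB ?leq_sub2l//; congr _%:R; rewrite subnS.
    by case: (k - p)%N (subn_gt0 p k) => [|j _]; rewrite ?pk//= subSnn.
  have /eqP-> : (k - p == 0)%N by rewrite subn_eq0.
  by have /eqP-> : (k - p.+1 == 0)%N; rewrite ?subrr// subn_eq0 leqW.
rewrite opprD addrACA lerD2l exprS.
rewrite le_eqVlt; apply/orP; left; apply/eqP; field.
by rewrite !gt_eqF.
Qed.

(** Summing the tails counts the [p]-th weight [p + 1] times, whence the square of [lam - 1]. *)
Lemma sum_decrement_le (K B : R) (m : nat -> R) P : 0 <= K ->
  (forall p, m p <= B * r ^+ p) ->
  (forall p, m p - m p.+1 = K * weight p) ->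
  \sum_(p < P) m p <= K * (k%:R ^+ 2 + s * lam / (lam - 1) ^+ 2).
Proof.
move=> K0 mB dm.
apply: (@le_trans _ _ (\sum_(p < P) K * ((k - p)%:R + s / (lam - 1) * r ^+ p))).
  by apply: ler_sum => p _; exact: decrement_le mB dm p.
rewrite -mulr_sumr ler_wpM2l// big_split/= lerD ?sum_subn_nat//.
rewrite -mulr_sumr sum_geometric mulrA.
rewrite (_ : s / (lam - 1) * (lam / (lam - 1)) =
  s * lam / (lam - 1) ^+ 2); last first.
  by field; rewrite gt_eqF.
rewrite ler_piMr ?mulr_ge0 ?divr_ge0 ?invr_ge0 ?sqr_ge0 ?(ltW lam_gt0)//.
by rewrite gerBl; have /andP[/ltW] := expr_invr_itv P.
Qed.

End upper.

Section lower.
Variable l : R.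
Hypothesis (pr_ge : forall p, l <= pr p).

Lemma weight_ge p : l * r ^+ p.+1 <= weight p.
Proof.
have /andP[x0 _] := expr_invr_itv p.+1.
by rewrite /weight mulrC ler_wpM2l// ltW.
Qed.

Lemma sum_weight_ge P : l / (lam - 1) * (1 - r ^+ P) <= \sum_(p < P) weight p.
Proof.
apply: (@le_trans _ _ (\sum_(p < P) (l * r ^+ p.+1))); last first.
  by apply: ler_sum => p _; exact: weight_ge.
under eq_bigr do rewrite exprS mulrA.
rewrite -mulr_sumr sum_geometric le_eqVlt; apply/orP; left; apply/eqP; field.
by rewrite !gt_eqF.
Qed.

Lemma decrement_ge (K : R) (m : nat -> R) : 0 <= K -> (forall p, 0 <= m p) ->
  (forall p, m p - m p.+1 = K * weight p) ->
  forall p, K * (l / (lam - 1)) * r ^+ p <= m p.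
Proof.
move=> K0 m0 dm.
apply: (le_of_decrements (B := K * (l / (lam - 1))) invr_itv01) => p.
  by rewrite gerBl.
rewrite dm; have -> : K * (l / (lam - 1)) * r ^+ p - K * (l / (lam - 1)) * r ^+ p.+1
   = K * (l * r ^+ p.+1).
  by rewrite exprS; field; rewrite !gt_eqF.
by rewrite ler_wpM2l// weight_ge.
Qed.

Lemma sum_decrement_ge (K : R) (m : nat -> R) (P : nat) : 0 <= K ->
  (forall p, 0 <= m p) ->
  (forall p, m p - m p.+1 = K * weight p) ->
  K * (l * lam / (lam - 1) ^+ 2) * (1 - r ^+ P) <= \sum_(p < P) m p.
Proof.
move=> K0 m0 dm.
apply: (@le_trans _ _ (\sum_(p < P) K * (l / (lam - 1)) * r ^+ p)); last first.
  by apply: ler_sum => p _; exact: decrement_ge m0 dm p.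
rewrite -mulr_sumr sum_geometric le_eqVlt; apply/orP; left; apply/eqP; field.
by rewrite !gt_eqF.
Qed.

End lower.
End geometric.

(* In the application [E i p = expR (t * e i p)] and [G i = expR (t * g i)], where
   [e i p] and [g i] are the values of the potential on the cylinders
   [i^(p+2) (~~ i)] and [i (~~ i)]; [n i p] is the eigenmeasure of
   [i^(p+1) (~~ i)], [N i] that of [i], and [H i p] the value of the
   eigenfunction on [i^(p+1) (~~ i)]. *)
Section masses.
Variables (R : realType) (lam : R) (E n : bool -> nat -> R) (G N : bool -> R).
Hypotheses (lam_gt1 : 1 < lam) (G_gt0 : forall i, 0 < G i)
  (G_le1 : G false * G true <= 1)
  (E_itv : forall i p, 0 < E i p <= 1) (N_gt0 : forall i, 0 < N i).
Hypotheses (n0 : forall i, lam * n i 0%N = G i * N (~~ i))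
  (nS : forall i p, lam * n i p.+1 = E i p * n i p)
  (N_ge : forall i P, \sum_(p < P) n i p <= N i)
  (N_le : forall i P, N i <= \sum_(p < P) n i p + lam^-1 ^+ P * N i).
Local Notation r := lam^-1.
Local Notation Pr i := (fun p => \prod_(j < p) E i j).

Let eps_gt0 : 0 < lam - 1. Proof. by rewrite subr_gt0. Qed.
Let lam_gt0 : 0 < lam. Proof. exact: lt_trans lam_gt1. Qed.
Let GN_gt0 i : 0 < G i * N (~~ i). Proof. by rewrite mulr_gt0. Qed.

(** Each symbol [i] of the cylinder costs one use of the eigenmeasure equation. Summed over [p],
    this makes [N i] equal to [G i * N (~~ i)] times A_i, the link between the two symbols. *)
Lemma mass_return i p : n i p = weight lam (Pr i) p * (G i * N (~~ i)).
Proof.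
apply: (mulfI (lt0r_neq0 lam_gt0)).
elim: p => [|p IH].
  by rewrite n0 /weight big_ord0 expr1 mulr1 mulrA mulfV ?gt_eqF// mul1r.
rewrite nS; have -> : n i p = r * (lam * n i p) by rewrite mulKf ?gt_eqF.
rewrite IH /weight big_ord_recr/= [r ^+ p.+2]exprS; field.
by rewrite gt_eqF.
Qed.

Lemma prod_itv i p : 0 < \prod_(j < p) E i j <= 1.
Proof.
have p0 : 0 < \prod_(j < p) E i j.
  by apply: prodr_gt0 => j _; have /andP[] := E_itv i j.
rewrite p0 prodr_ile1// => j; have /andP[/ltW e0 e1] := E_itv i j.
by rewrite e0.
Qed.

Lemma sum_weight_mass i P :
  (\sum_(p < P) weight lam (Pr i) p) * (G i * N (~~ i)) <= N i.
Proof.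
rewrite mulr_suml; apply: le_trans (N_ge i P).
by apply: ler_sum => p _; rewrite mass_return.
Qed.

Lemma mass_le i k s : 0 <= s ->
  (forall p, \prod_(j < p) E i j <= (p < k)%:R + s) ->
  N i <= (k%:R + s / (lam - 1)) * (G i * N (~~ i)).
Proof.
move=> s0 prs; apply: (@le_of_geometric _ _ _ (N i) r) => [|P].
  exact: invr_itv01.
rewrite [N i * _]mulrC; apply: le_trans (N_le i P) _; rewrite lerD2r.
apply: (@le_trans _ _ ((\sum_(p < P) weight lam (Pr i) p) * (G i * N (~~ i)))).
  by rewrite mulr_suml; apply: ler_sum => p _; rewrite mass_return.
by rewrite ler_wpM2r ?(ltW (GN_gt0 i))//; exact: sum_weight_le.
Qed.

Lemma mass_ge i l : (forall p, l <= \prod_(j < p) E i j) ->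
  l / (lam - 1) * (G i * N (~~ i)) <= N i.
Proof.
move=> prl.
apply: (@le_of_geometric _ _ _ (l / (lam - 1) * (G i * N (~~ i))) r) => [|P].
  exact: invr_itv01.
rewrite -lerBlDr -[X in X - _]mulr1 -mulrBr mulrAC.
apply: le_trans (sum_weight_mass i P); rewrite ler_wpM2r ?(ltW (GN_gt0 i))//.
exact: sum_weight_ge.
Qed.

Lemma mass_ge_first i : G i * N (~~ i) <= lam * N i.
Proof.
rewrite -n0 ler_wpM2l ?(ltW lam_gt0)//.
by have := N_ge i 1%N; rewrite big_ord_recl big_ord0 addr0.
Qed.

(** With [k = 0] and [s = 1], A_i is at most [1 / (lam - 1)]; going from [N false] to [N true] and
    back gives [(lam - 1)^2 <= G false * G true <= 1]. *)
Lemma eigenvalue_le2 : lam <= 2.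
Proof.
have le1 i : N i <= (lam - 1)^-1 * (G i * N (~~ i)).
  have pr1 p : \prod_(j < p) E i j <= (p < 0)%:R + 1.
    by rewrite add0r; have /andP[] := prod_itv i p.
  by have := mass_le ler01 pr1; rewrite add0r mul1r.
have e1 : (lam - 1) ^+ 2 * N false <= G false * G true * N false.
  have := le1 false; rewrite -(ler_pM2l eps_gt0) mulVKf ?gt_eqF//= => a1.
  have := le1 true; rewrite -(ler_pM2l eps_gt0) mulVKf ?gt_eqF//= => a2.
  rewrite expr2 -mulrA; apply: (le_trans (ler_wpM2l (ltW eps_gt0) a1)).
  by rewrite mulrCA -mulrA ler_wpM2l ?(ltW (G_gt0 _)).
rewrite ler_pM2r// in e1.
have : (lam - 1) ^+ 2 <= 1 by exact: le_trans G_le1.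
by rewrite expr_le1 ?(ltW eps_gt0)// lerBlDr.
Qed.

(** In the relation [G false * G true] A_0 A_1 = 1, the series A_1 is bounded below by
    [l / (lam - 1)] and A_0 by its first term [1 / lam]. *)
Lemma eigenvalue_ge l : 0 <= l -> (forall p, l <= \prod_(j < p) E true j) ->
  l * (G false * G true) <= lam * (lam - 1).
Proof.
move=> l0 prl; have := mass_ge prl; have := mass_ge_first false => /= a1 a2.
rewrite -(ler_pM2r (N_gt0 true)).
rewrite mulrAC ler_pdivrMr// in a2.
rewrite [leLHS](_ : _ = l * G true * (G false * N true)); last by ring.
apply: (le_trans (ler_wpM2l _ a1)); first by rewrite mulr_ge0// ltW.
rewrite [leLHS](_ : _ = lam * (l * (G true * N false))); last by ring.
by rewrite -[leRHS]mulrA ler_wpM2l ?(ltW lam_gt0)// [leRHS]mulrC.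
Qed.

(** The same relation with both series bounded above; [N false] cancels after one round trip between
    the two symbols. *)
Lemma return_le k s : (forall i, 0 <= s i) ->
  (forall i p, \prod_(j < p) E i j <= (p < k)%:R + s i) ->
  1 <= G false * G true * (k%:R + s false / (lam - 1)) *
       (k%:R + s true / (lam - 1)).
Proof.
move=> s0 prs; have a0 := mass_le (s0 false) (prs false).
have a1 := mass_le (s0 true) (prs true); rewrite -(ler_pM2r (N_gt0 false)) mul1r.
apply: (le_trans a0) => /=.
rewrite [leRHS](_ : _ = (k%:R + s false / (lam - 1)) * (G false *
   ((k%:R + s true / (lam - 1)) * (G true * N false)))); last by ring.
rewrite ler_wpM2l ?addr_ge0 ?divr_ge0 ?(ltW eps_gt0)//.
by rewrite ler_wpM2l// ltW.
Qed.

(** * Masses weighted by the eigenfunction *)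

Section eigenfunction.
Variables (H : bool -> nat -> R) (M : bool -> R) (B : R).
Hypotheses (H_itv : forall i p, 0 < H i p <= B)
  (HS : forall i p, lam * H i p = E i p * H i p.+1 + G (~~ i) * H (~~ i) 0%N)
  (M_ge : forall i P, \sum_(p < P) H i p * n i p <= M i)
  (M_le : forall i P, M i <= \sum_(p < P) H i p * n i p + B * r ^+ P * N i).

(** In the application [m i p] is the Gibbs mass of [[i^(p+1) (~~ i)]], and [K i] is the constant
    K_i in the formula for mu[i]. *)
Let m i p := H i p * n i p.
Let K i := r * (G false * G true) * (H (~~ i) 0%N * N (~~ i)).

Let K_gt0 i : 0 < K i.
Proof.
have /andP[h0 _] := H_itv (~~ i) 0%N.
by rewrite /K !mulr_gt0 ?invr_gt0.
Qed.

Let n_gt0 i p : 0 < n i p.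
Proof.
rewrite mass_return mulr_gt0//; have /andP[p0 _] := prod_itv i p.
by rewrite /weight mulr_gt0// exprn_gt0// invr_gt0.
Qed.

Let m_ge0 i p : 0 <= m i p.
Proof. by have /andP[/ltW h0 _] := H_itv i p; rewrite mulr_ge0// ltW. Qed.

Let m_le i p : m i p <= B * (G i * N (~~ i)) * r ^+ p.
Proof.
have /andP[h0 hB] := H_itv i p; have B0 : 0 <= B by exact: le_trans (ltW h0) hB.
rewrite -mulrA; apply: ler_pM => //; rewrite ?(ltW h0) ?(ltW (n_gt0 _ _))//.
rewrite mass_return mulrC ler_wpM2l ?(ltW (GN_gt0 i))// /weight exprS.
have /andP[p0 p1] := prod_itv i p; have /andP[r0 r1] := invr_itv01 lam_gt1.
have /andP[x0 x1] := expr_invr_itv lam_gt1 p.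
apply: (@le_trans _ _ (r * r ^+ p)); first by rewrite ler_piMr ?mulr_ge0// ltW.
by rewrite ler_piMl// ltW.
Qed.

(** A trace of shift invariance: with [j = ~~ i], the masses of [[i^(p+1) j]] and [[i^(p+2) j]]
    differ by that of [[j i^(p+1) j]]. Algebraically, the [E] terms of the two eigen-equations
    cancel. *)
Let dm i p : m i p - m i p.+1 = K i * weight lam (Pr i) p.
Proof.
have e1 : H i p = r * (E i p * H i p.+1 + G (~~ i) * H (~~ i) 0%N).
  by rewrite -HS mulKf ?gt_eqF.
have e2 : n i p.+1 = r * (E i p * n i p) by rewrite -nS mulKf ?gt_eqF.
rewrite /m /K e1 e2 mulrDr [_ * n i p]mulrDl addrAC.
rewrite (_ : r * (E i p * H i p.+1) * n i p =
  H i p.+1 * (r * (E i p * n i p))); last by ring.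
rewrite subrr add0r mass_return.
have -> : G false * G true = G i * G (~~ i) by case: i {e1 e2} => //=; rewrite mulrC.
by ring.
Qed.

Lemma cylinder_mass_le i k s : 0 <= s ->
  (forall p, \prod_(j < p) E i j <= (p < k)%:R + s) ->
  M i <= K i * (k%:R ^+ 2 + s * lam / (lam - 1) ^+ 2).
Proof.
move=> s0 prs; apply: (@le_of_geometric _ _ _ (B * N i) r) => [|P].
  exact: invr_itv01.
rewrite [B * N i * _]mulrAC; apply: (le_trans (M_le i P)); rewrite lerD2r.
exact: (sum_decrement_le lam_gt1 s0 prs P (ltW (K_gt0 i)) (m_le i) (dm i)).
Qed.

Lemma cylinder_mass_ge i l :
  (forall p, l <= \prod_(j < p) E i j) ->
  K i * (l * lam / (lam - 1) ^+ 2) <= M i.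
Proof.
move=> prl.
apply: (@le_of_geometric _ _ _ (K i * (l * lam / (lam - 1) ^+ 2)) r) => [|P].
  exact: invr_itv01.
rewrite -lerBlDr.
rewrite [leLHS](_ : _ = K i * (l * lam / (lam - 1) ^+ 2) * (1 - r ^+ P)); last first.
  by rewrite mulrBr mulr1.
apply: le_trans (M_ge i P).
exact: (sum_decrement_ge lam_gt1 prl P (ltW (K_gt0 i)) (m_ge0 i) (dm i)).
Qed.

Lemma cylinder_mass_gt0 i : 0 < M i.
Proof.
apply: (@lt_le_trans _ _ (m i 0%N)).
  by have /andP[h0 _] := H_itv i 0; rewrite mulr_gt0.
by have := M_ge i 1%N; rewrite big_ord_recl big_ord0 addr0.
Qed.

Lemma eigenfunction_ge_first i : G (~~ i) * H (~~ i) 0%N <= lam * H i 0%N.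
Proof.
rewrite HS lerDr; have /andP[e0 _] := E_itv i 0%N.
by have /andP[h0 _] := H_itv i 1%N; rewrite mulr_ge0// ltW.
Qed.

(** [K false] involves [H true 0] and [N true], and [K true] their counterparts at [false]; each
    exchange keeps one term of an eigen-equation and costs a factor [lam]. *)
Let K_ratio : K false * (G false * G true) <= lam ^+ 2 * K true.
Proof.
rewrite /K /= [leLHS](_ : _ = r * (G false * G true) *
  ((G true * H true 0%N) * (G false * N true))); last by ring.
rewrite [leRHS](_ : _ = r * (G false * G true) *
  ((lam * H false 0%N) * (lam * N false))); last by ring.
rewrite ler_wpM2l//; first by rewrite !mulr_ge0 ?invr_ge0// ltW.
have /andP[h0 _] := H_itv true 0%N.
apply: ler_pM; [by rewrite mulr_ge0// ltW|by rewrite mulr_ge0// ltW| |].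
  exact: (eigenfunction_ge_first false).
exact: (mass_ge_first false).
Qed.

(** Quotient of the upper bound for [M false] and the lower bound for [M true], with denominators
    cleared. The factor [G false * G true] is the cost of comparing [K false] with [K true]. *)
Lemma cylinder_ratio_le k s l : 0 <= s -> 0 <= l ->
  (forall p, \prod_(j < p) E false j <= (p < k)%:R + s) ->
  (forall p, l <= \prod_(j < p) E true j) ->
  M false * (l * (G false * G true)) <=
    (2 * k%:R ^+ 2 * (lam - 1) ^+ 2 + 4 * s) * M true.
Proof.
move=> s0 l0 prs prl.
have a0 := cylinder_mass_le s0 prs.
have a1 := cylinder_mass_ge prl.
set e2 := (lam - 1) ^+ 2 in a0 a1 *.
have e20 : 0 < e2 by rewrite exprn_gt0.
set g := G false * G true; have g0 : 0 < g by rewrite mulr_gt0.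
have k2 : 0 <= (k%:R : R) ^+ 2 by rewrite sqr_ge0.
have b0 : e2 * M false <= K false * (k%:R ^+ 2 * e2 + s * lam).
  rewrite (_ : K false * _ = e2 * (K false * (k%:R ^+ 2 + s * lam / e2))).
    by rewrite ler_wpM2l// ltW.
  by field; rewrite gt_eqF.
have b1 : K true * (l * lam) <= e2 * M true.
  rewrite (_ : K true * _ = e2 * (K true * (l * lam / e2))).
    by rewrite ler_wpM2l// ltW.
  by field; rewrite gt_eqF.
set c := k%:R ^+ 2 * e2 + s * lam in b0.
have c0 : 0 <= c by rewrite /c addr_ge0 ?mulr_ge0// ltW.
have b2 : e2 * (M false * (l * g)) <= e2 * (lam * c * M true).
  apply: (@le_trans _ _ (K false * c * (l * g))).
    by rewrite mulrA ler_wpM2r// mulr_ge0// ltW.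
  rewrite [leLHS](_ : _ * _ = c * l * (K false * g)); last by ring.
  apply: (@le_trans _ _ (c * l * (lam ^+ 2 * K true))).
    by rewrite ler_wpM2l ?mulr_ge0.
  rewrite [leLHS](_ : _ * _ = lam * c * (K true * (l * lam))); last by ring.
  rewrite [leRHS]mulrCA ler_wpM2l// mulr_ge0// ltW//.
rewrite ler_pM2l// in b2; apply: (le_trans b2).
rewrite ler_wpM2r ?(ltW (cylinder_mass_gt0 _))//.
(* Here [lam * c] is [lam * k^2 * e2 + lam^2 * s], and [lam <= 2] produces the constants 2 and 4. *)
have lam2 := eigenvalue_le2; rewrite /c mulrDr.
apply: lerD.
  by rewrite mulrA ler_wpM2r ?(ltW e20)// ler_wpM2r.
rewrite mulrCA mulrC ler_wpM2r//; apply: (@le_trans _ _ (2 * 2)).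
  by apply: ler_pM => //; exact: ltW.
by rewrite -natrM.
Qed.

(** Controls finite runs of 1 by [[0]], which is what sends the mass of [[1]] to the fixed point.
    The masses [m true p] are nonincreasing in [p], and the first one is compared with that of
    [[01]]. *)
Lemma cylinder_first_le k s p : 0 <= s ->
  (forall p, \prod_(j < p) E false j <= (p < k)%:R + s) ->
  H true p * n true p <= lam * (k%:R + s / (lam - 1)) * M false.
Proof.
move=> s0 prs; apply: (@le_trans _ _ (m true 0%N)).
  rewrite -/(m true p); elim: p => // p IH; apply: le_trans IH.
  rewrite -subr_ge0 dm mulr_ge0 ?(ltW (K_gt0 _))// /weight.
  have /andP[/ltW p0 _] := prod_itv true p.
  by rewrite mulr_ge0// exprn_ge0// invr_ge0 ltW.
have A0 : 0 <= k%:R + s / (lam - 1) by rewrite addr_ge0// divr_ge0// ltW.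
apply: (@le_trans _ _ (lam * (k%:R + s / (lam - 1)) * m false 0%N)); last first.
  rewrite ler_wpM2l ?mulr_ge0 ?(ltW lam_gt0)//.
  by have := M_ge false 1%N; rewrite big_ord_recl big_ord0 addr0.
rewrite -(ler_pM2l lam_gt0) /m.
rewrite [leLHS](_ : _ = H true 0%N * (lam * n true 0%N)); last by ring.
rewrite [leRHS](_ : _ = (k%:R + s / (lam - 1)) * (lam * H false 0%N) *
  (lam * n false 0%N)); last by ring.
rewrite !n0 /=; have a0 := mass_le s0 prs; have /andP[h0 _] := H_itv true 0%N.
apply: (@le_trans _ _ (H true 0%N * (G true *
   ((k%:R + s / (lam - 1)) * (G false * N true))))).
  by rewrite !ler_wpM2l ?(ltW h0) ?(ltW (G_gt0 _)).
rewrite [leLHS](_ : _ = (k%:R + s / (lam - 1)) * (G true * H true 0%N) *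
  (G false * N true)); last by ring.
rewrite ler_wpM2r ?(ltW (GN_gt0 false))// ler_wpM2l//.
exact: (eigenfunction_ge_first false).
Qed.

End eigenfunction.
End masses.

(** * Runs and the Ruelle operator *)

Definition scons (i : bool) (x : full_shift) : full_shift :=
  fun n => if n is m.+1 then x m else i.

Lemma scons_shift x : scons (x 0%N) (shift x) = x.
Proof. by apply/funext => -[]. Qed.

Lemma scons_const i : scons i (const_seq i) = const_seq i.
Proof. by apply/funext => -[]. Qed.

Lemma prepend_cons i w x : prepend (i :: w) x = scons i (prepend w x).
Proof. by apply/funext => -[]. Qed.

Lemma prepend_nil x : prepend [::] x = x.
Proof. by apply/funext => n; rewrite /prepend/= subn0. Qed.

Lemma prepend_run i p j z :
  prepend (rcons (nseq p i) j) z = iter p (scons i) (scons j z).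
Proof. by elim: p => [|p IH]/=; rewrite prepend_cons ?prepend_nil ?IH. Qed.

Lemma agree_scons n i x y : agree n x y -> agree n.+1 (scons i x) (scons i y).
Proof. by move=> xy []. Qed.

Lemma agree_leq m n x y : (m <= n)%N -> agree n x y -> agree m x y.
Proof. by move=> mn xy i im; apply: xy; exact: leq_trans mn. Qed.

(** Indicators of [[i^p]] and, below, of [[i^p (~~ i)]], recursive along [shift] so that they reduce
    by computation on [scons i x]. *)
Fixpoint starts (i : bool) (p : nat) (x : full_shift) : bool :=
  if p is p'.+1 then (x 0%N == i) && starts i p' (shift x) else true.

Fixpoint block (i : bool) (p : nat) (x : full_shift) : bool :=
  if p is p'.+1 then (x 0%N == i) && block i p' (shift x)
  else x 0%N == ~~ i.

Lemma blockP i p x : block i p x ->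
  exists z, x = iter p (scons i) (scons (~~ i) z).
Proof.
elim: p x => [|p IH] x /=.
  by move=> /eqP x0; exists (shift x); rewrite -x0 scons_shift.
by move=> /andP[/eqP x0 /IH[z xz]]; exists z; rewrite -xz -x0 scons_shift.
Qed.

Lemma starts_block i p x : starts i p x = starts i p.+1 x (+) block i p x.
Proof.
elim: p x => [|p IH] x /=; first by case: (x 0%N) i => [] [].
by rewrite IH /=; case: eqP.
Qed.

Lemma starts_blockR (R : realType) i p x :
  (starts i p x)%:R = (block i p x)%:R + (starts i p.+1 x)%:R :> R.
Proof.
elim: p x => [|p IH] x /=.
  by case: (x 0%N) i => [] []; rewrite /= ?add0r ?addr0.
by case: eqP => _ /=; rewrite ?addr0//; exact: IH.
Qed.

Lemma starts_const i x : (forall p, starts i p x) -> x = const_seq i.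
Proof.
move=> sx; apply/funext => n; have {sx} := sx n.+1.
by elim: n x => [|n IH] x /= /andP[/eqP// _]; exact: IH.
Qed.

Lemma runP i x : x = const_seq i \/
  exists p z, x = iter p (scons i) (scons (~~ i) z).
Proof.
have [|nx] := pselect (forall p, starts i p x); first by left; exact: starts_const.
right; have [p np] : exists p, block i p x.
  apply: contrapT => /forallNP nb; apply: nx; elim=> // p IH.
  by move: IH; rewrite starts_block; have /negP/negbTE-> := nb p; rewrite addbF.
by exists p; exact: blockP.
Qed.

Lemma starts_agree i p x y : agree p x y -> starts i p x = starts i p y.
Proof.
elim: p x y => //= p IH x y xy; rewrite xy//; congr andb.
by apply: IH => j jp; exact: xy.
Qed.

Lemma block_agree i p x y : agree p.+1 x y -> block i p x = block i p y.
Proof.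
elim: p x y => /= [|p IH] x y xy; first by rewrite xy.
by rewrite xy//; congr andb; apply: IH => j jp; exact: xy.
Qed.

Lemma cylinder_starts i p : cylinder (nseq p i) = [set x | starts i p x].
Proof.
apply/funext => x; apply/propext; split => /=; rewrite /cylinder/= size_nseq.
  elim: p x => //= p IH x xi; rewrite xi// eqxx/=; apply: IH => j jp.
  exact: (xi j.+1).
elim: p x => //= p IH x /andP[/eqP x0 sx] [|j] jp //=.
exact: (IH (shift x)).
Qed.

Section ruelle.
Variables (R : realType) (f : full_shift -> R) (t : R).
Implicit Types w v : full_shift -> R.

Lemma ruelleE w x : ruelle f t w x =
  expR (t * f (scons false x)) * w (scons false x) +
  expR (t * f (scons true x)) * w (scons true x).
Proof.
rewrite /ruelle (_ : [set y | _] = [set scons false x] `|` [set scons true x]).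
  rewrite fsbigU0 ?fsbig_set1//.
  by move=> y [/= -> /(congr1 (@^~ 0%N))].
apply/seteqP; split => y /=; last by case=> ->.
move=> <-; rewrite -[y in y = _ \/ _]scons_shift -[y in _ \/ y = _]scons_shift.
by case: (y 0%N); [right|left].
Qed.

Lemma ruelle_branch i w x :
  ruelle f t w x = expR (t * f (scons i x)) * w (scons i x) +
    expR (t * f (scons (~~ i) x)) * w (scons (~~ i) x).
Proof. by rewrite ruelleE; case: i => //=; rewrite addrC. Qed.

Lemma ruelle_branch0 i w x : w (scons (~~ i) x) = 0 ->
  ruelle f t w x = expR (t * f (scons i x)) * w (scons i x).
Proof. by rewrite (ruelle_branch i) => ->; rewrite mulr0 addr0. Qed.

End ruelle.

(** * Integrals of continuous functions and of indicators of runs *)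

Section integral.
Variables (R : realType) (nu : {finite_measure set full_shift -> \bar R}).
Implicit Types w v : full_shift -> R.
Local Notation I w := (\int[nu]_x w x).

Lemma starts_continuous i p : continuous (fun x => (starts i p x)%:R : R).
Proof.
by apply: (@locally_constant_continuous _ _ p) => x y /starts_agree ->.
Qed.

Lemma block_continuous i p : continuous (fun x => (block i p x)%:R : R).
Proof.
by apply: (@locally_constant_continuous _ _ p.+1) => x y /block_agree ->.
Qed.

Lemma measurable_continuous_indicator (b : full_shift -> bool) :
  continuous (fun x => (b x)%:R : R) -> measurable [set x | b x].
Proof.
move=> /continuous_measurable/(_ measurableT [set 1%R] (measurable_set1 _)).
rewrite setTI (_ : _ @^-1` _ = [set x | b x])//.
apply/seteqP; split=> x /=; last by move=> ->.
by case: (b x) => // /eqP; rewrite eq_sym oner_eq0.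
Qed.

Lemma integral_indicator (b : full_shift -> bool) :
  continuous (fun x => (b x)%:R : R) ->
  I (fun x => (b x)%:R) = fine (nu [set x | b x]).
Proof.
move=> cb; rewrite -[in RHS](setIT [set x | b x]) -integral_indic//; last first.
  exact: measurable_continuous_indicator.
congr fine; apply: eq_integral => x _; rewrite indicE.
by case: (boolP (b x)) => bx; [rewrite mem_set|rewrite memNset//; exact/negP].
Qed.

Lemma le_integral_continuous w v : continuous w -> continuous v ->
  (forall x, w x <= v x) -> I w <= I v.
Proof.
by move=> cw cv wv; apply: le_Rintegral => //; exact: continuous_integrable.
Qed.

Lemma integralD_continuous w v : continuous w -> continuous v ->
  I (fun x => w x + v x) = I w + I v.
Proof. by move=> cw cv; apply: RintegralD => //; exact: continuous_integrable. Qed.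

Lemma integralZ_continuous k w : continuous w -> I (fun x => k * w x) = k * I w.
Proof. by move=> cw; apply: RintegralZl => //; exact: continuous_integrable. Qed.

(** Splits [[i]] by the length of its initial run; used with [w = 1] and with [w = h]. *)
Lemma integral_starts_block i w P : continuous w ->
  I (fun x => (starts i 1 x)%:R * w x) =
  \sum_(p < P) I (fun x => (block i p.+1 x)%:R * w x) +
  I (fun x => (starts i P.+1 x)%:R * w x).
Proof.
move=> cw; elim: P => [|P ->]; first by rewrite big_ord0 add0r.
rewrite big_ord_recr/= -addrA -integralD_continuous; last 2 first.
- by move=> x; apply: cvgM; [exact: (@block_continuous i P.+1)|exact: cw].
- by move=> x; apply: cvgM; [exact: (@starts_continuous i P.+2)|exact: cw].
congr (_ + _); apply: eq_Rintegral => x _; rewrite -mulrDl; congr (_ * _).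
exact: (starts_blockR R i P.+1 x).
Qed.

End integral.

(** * Relations satisfied by the eigenmeasure and the eigenfunction *)

Section eigendata.
Variables (R : realType) (f : full_shift -> R) (e : bool -> nat -> R)
  (g : bool -> R) (t lam : R).
Variables (h : full_shift -> R) (nu : {finite_measure set full_shift -> \bar R}).
Hypotheses
  (f_run : forall i p (y : full_shift), y 0%N = ~~ i ->
    f (scons i (iter p.+1 (scons i) y)) = e i p)
  (f_switch : forall i (x : full_shift), x 0%N = ~~ i -> f (scons i x) = g i)
  (f_const : forall i, f (const_seq i) = 0)
  (e_lt0 : forall i p, e i p < 0) (g_lt0 : forall i, g i < 0) (t_gt0 : 0 < t).
Hypotheses (ch : continuous h) (h_gt0 : forall x, 0 < h x)
  (h_eigen : forall x, ruelle f t h x = lam * h x)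
  (nu_eigen : forall w, continuous w ->
    \int[nu]_x ruelle f t w x = lam * \int[nu]_x w x)
  (h_nu : \int[nu]_x h x = 1).

Local Notation r := lam^-1.
Local Notation E i p := (expR (t * e i p)).
Local Notation G i := (expR (t * g i)).
Local Notation N i := (\int[nu]_x (starts i 1 x)%:R).
Local Notation n i p := (\int[nu]_x (block i p.+1 x)%:R).

Lemma eigenvalue_gt1 : 1 < lam.
Proof.
have := h_eigen (const_seq false).
rewrite (ruelle_branch _ _ false) scons_const f_const mulr0 expR0 mul1r => e0.
rewrite -(ltr_pM2r (h_gt0 (const_seq false))) mul1r -e0 ltrDl.
by rewrite mulr_gt0 ?expR_gt0.
Qed.
Let lam_gt1 := eigenvalue_gt1.
Let lam_gt0 : 0 < lam. Proof. exact: lt_trans lam_gt1. Qed.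

Lemma block_first_measure i : lam * n i 0%N = G i * N (~~ i).
Proof.
rewrite -nu_eigen; last exact: (@block_continuous _ i 1).
rewrite -integralZ_continuous; last exact: (@starts_continuous _ (~~ i) 1).
apply: eq_Rintegral => x _.
rewrite (@ruelle_branch0 _ _ _ i); last by rewrite /= ; case: i.
rewrite /= eqxx /= andbT; case: eqP => [x0|]; last by rewrite !mulr0.
by rewrite f_switch.
Qed.

Lemma block_next_measure i p : lam * n i p.+1 = E i p * n i p.
Proof.
rewrite -nu_eigen; last exact: (@block_continuous _ i p.+2).
rewrite -integralZ_continuous; last exact: (@block_continuous _ i p.+1).
apply: eq_Rintegral => x _.
rewrite (@ruelle_branch0 _ _ _ i); last by rewrite /= ; case: i.
rewrite [block i p.+2 _](_ : _ = block i p.+1 x); last by rewrite /= eqxx.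
case: (boolP (block i p.+1 x)) => [/blockP[z ->]|]; last by rewrite !mulr0.
by rewrite f_run.
Qed.

Lemma potential_le0 i x : x 0%N = i -> f (scons i x) <= 0.
Proof.
case: (runP i x) => [->|[[|p] [z ->]]] => x0; first by rewrite scons_const f_const.
  by move: x0 => /=; case: i.
by rewrite f_run//; exact/ltW.
Qed.

Lemma scons_continuous j : continuous (fun x => h (scons j x)).
Proof.
apply: agree_continuous => d /(continuous_agree ch)[k hk]; exists k => x y xy.
by apply: hk; apply: agree_leq (agree_scons j xy).
Qed.

(** Prepending [i] inside [[i]] has weight at most 1, the potential being nonpositive there; the
    measure of [[i^P]] thus decays at least like [lam^-P]. *)
Lemma starts_next_measure i P :
  lam * \int[nu]_x (starts i P.+2 x)%:R <= \int[nu]_x (starts i P.+1 x)%:R.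
Proof.
rewrite -nu_eigen; last exact: (@starts_continuous _ i P.+2).
have -> : \int[nu]_x ruelle f t (fun x => (starts i P.+2 x)%:R) x =
   \int[nu]_x (expR (t * f (scons i x)) * (starts i P.+1 x)%:R).
  apply: eq_Rintegral => x _.
  rewrite (@ruelle_branch0 _ _ _ i); last by rewrite /= ; case: i.
  by rewrite /= eqxx.
apply: le_integral_continuous => [||x].
(* Continuity of the weight of the branch [i] is read off the eigenfunction equation, solved for
   that weight on [[i]]; elsewhere the factor [starts] vanishes. *)
- rewrite (_ : (fun x => _) = (fun x => (starts i P.+1 x)%:R *
    ((lam * h x - G (~~ i) * h (scons (~~ i) x)) / h (scons i x)))).
    move=> x; apply: cvgM; first exact: (@starts_continuous _ i P.+1).
    apply: cvgM; last by apply: cvgV; [rewrite gt_eqF|exact: scons_continuous].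
    apply: cvgB; first by apply: cvgMr; exact: ch.
    by apply: cvgMr; exact: scons_continuous.
  apply/funext => x; case: (boolP (starts i P.+1 x)); last by rewrite mulr0 mul0r.
  move=> /= /andP[/eqP x0 _]; rewrite mulr1 mul1r -h_eigen (ruelle_branch _ _ i).
  by rewrite (@f_switch (~~ i)) ?negbK// addrK mulfK// gt_eqF.
- exact: (@starts_continuous _ i P.+1).
- case: (boolP (starts i P.+1 x)) => [/= /andP[/eqP x0 _]|]; last by rewrite mulr0.
  rewrite mulr1 -[leRHS]expR0 ler_expR pmulr_rle0//; exact: potential_le0.
Qed.

Lemma tail_measure i P :
  \int[nu]_x (starts i P.+1 x)%:R <= r ^+ P * N i.
Proof.
elim: P => [|P IH]; first by rewrite expr0 mul1r.
rewrite exprS -mulrA -(ler_pM2l lam_gt0) mulVKf ?gt_eqF//.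
exact: le_trans (starts_next_measure i P) IH.
Qed.

Lemma starts_measureE i P :
  N i = \sum_(p < P) n i p + \int[nu]_x (starts i P.+1 x)%:R.
Proof.
have -> : N i = \int[nu]_x ((starts i 1 x)%:R * 1).
  by apply: eq_Rintegral => x _; rewrite mulr1.
have c1 : continuous ((fun=> 1) : full_shift -> R) by exact: cst_continuous.
rewrite (integral_starts_block nu i P c1); congr (_ + _).
  by apply: eq_bigr => p _; apply: eq_Rintegral => x _; rewrite mulr1.
by apply: eq_Rintegral => x _; rewrite mulr1.
Qed.

Lemma sum_block_measure_le i P : \sum_(p < P) n i p <= N i.
Proof. by rewrite (starts_measureE i P) lerDl; apply: Rintegral_ge0. Qed.

Lemma starts_measure_le i P : N i <= \sum_(p < P) n i p + r ^+ P * N i.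
Proof. by rewrite [leLHS](starts_measureE i P) lerD2l; exact: tail_measure. Qed.

(** If [N i] vanished, so would [N (~~ i)] by the equation for the first block, and the integral of
    [h] would be 0 instead of 1. *)
Lemma starts_measure_gt0 i : 0 < N i.
Proof.
have N0 j : 0 <= N j by apply: Rintegral_ge0.
have GN j : G j * N (~~ j) <= lam * N j.
  rewrite -block_first_measure ler_wpM2l ?(ltW lam_gt0)//.
  by have := sum_block_measure_le j 1%N; rewrite big_ord_recl big_ord0 addr0.
rewrite lt_neqAle N0 andbT; apply/negP => /eqP Ni0.
have Nj0 : N (~~ i) = 0.
  apply/le_anti; rewrite N0 andbT -(pmulr_rle0 _ (expR_gt0 (t * g i))).
  by apply: le_trans (GN i) _; rewrite -Ni0 mulr0.
have [B B0 hB] := continuous_bounded ch.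
have : \int[nu]_x h x <= B * N i + B * N (~~ i).
  rewrite -!integralZ_continuous; last 2 first.
  - exact: (@starts_continuous _ (~~ i) 1).
  - exact: (@starts_continuous _ i 1).
  rewrite -integralD_continuous; last 2 first.
  - by move=> x; apply: cvgMr; exact: (@starts_continuous _ i 1).
  - by move=> x; apply: cvgMr; exact: (@starts_continuous _ (~~ i) 1).
  apply: le_integral_continuous => // [x|x].
    by apply: cvgD; apply: cvgMr;
      [exact: (@starts_continuous _ i 1)|exact: (@starts_continuous _ (~~ i) 1)].
  have sE : (starts i 1 x)%:R + (starts (~~ i) 1 x)%:R = 1 :> R.
    rewrite /= !andbT; clear.
    by case: i (x 0%N) => [] []; rewrite /= ?addr0 ?add0r.
  rewrite -[leRHS]mulrDr [X in _ * X]sE mulr1.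
  exact: le_trans (ler_norm _) (hB x).
by rewrite h_nu Nj0 -Ni0 !mulr0 addr0 ler10.
Qed.

Let E_itv i p : 0 < E i p <= 1.
Proof. by rewrite expR_gt0 -[leRHS]expR0 ler_expR pmulr_rle0// ltW. Qed.

Let G_gt0 i : 0 < G i. Proof. exact: expR_gt0. Qed.

Lemma eigenfunction_step i p (y : full_shift) : y 0%N = ~~ i ->
  lam * h (iter p.+1 (scons i) y) = E i p * h (iter p.+2 (scons i) y) +
    G (~~ i) * h (scons (~~ i) (iter p.+1 (scons i) y)).
Proof.
move=> y0; rewrite -h_eigen (ruelle_branch _ _ i) f_run//.
by rewrite (@f_switch (~~ i)) ?negbK.
Qed.

(** Iterating the eigenfunction equation along a run bounds the oscillation by [D * G (~~ i)] times
    a partial sum of A_i, plus a remainder of order [lam^-P]; that partial sum is at most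
    [N i / (G i * N (~~ i))]. *)
Lemma oscillation_le i (D : R) (y z : full_shift) :
  y 0%N = ~~ i -> z 0%N = ~~ i ->
  (forall p, `|h (scons (~~ i) (iter p.+1 (scons i) y)) -
               h (scons (~~ i) (iter p.+1 (scons i) z))| <= D) ->
  `|h (scons i y) - h (scons i z)| <= D * (G (~~ i) * N i) / (G i * N (~~ i)).
Proof.
move=> y0 z0 hD; have [B B0 hB] := continuous_bounded ch.
have D0 : 0 <= D by exact: le_trans (hD 0%N).
have GN0 : 0 < G i * N (~~ i) by rewrite mulr_gt0// starts_measure_gt0.
pose d p := `|h (iter p.+1 (scons i) y) - h (iter p.+1 (scons i) z)|.
have d_rec p : lam * d p <= E i p * d p.+1 + G (~~ i) * D.
  rewrite /d -[X in X * _ <= _](gtr0_norm lam_gt0) -normrM mulrBr.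
  rewrite !eigenfunction_step// opprD addrACA -!mulrBr.
  apply: le_trans (ler_normD _ _) _; rewrite !normrM.
  have /andP[/ltW/ger0_norm-> _] := E_itv i p; rewrite (gtr0_norm (G_gt0 _)).
  by rewrite lerD2l ler_wpM2l ?(ltW (G_gt0 _)).
pose pr p := \prod_(j < p) E i j.
have pr01 p : 0 < pr p <= 1 by exact: (@prod_itv R (fun i p => E i p) E_itv).
have dP P : d 0%N <= G (~~ i) * D * (\sum_(p < P) weight lam pr p) +
    r ^+ P * pr P * d P.
  elim: P => [|P IH].
    by rewrite big_ord0 mulr0 add0r /pr big_ord0 expr0 !mul1r.
  apply: le_trans IH _; rewrite big_ord_recr/= mulrDr -addrA lerD2l.
  have /andP[/ltW p0 _] := pr01 P; have /andP[/ltW x0 _] := expr_invr_itv lam_gt1 P.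
  have -> : d P = r * (lam * d P) by rewrite mulKf ?gt_eqF.
  apply: (@le_trans _ _ (r ^+ P * pr P * (r * (E i P * d P.+1 + G (~~ i) * D)))).
    by rewrite ler_wpM2l ?mulr_ge0// ler_wpM2l ?invr_ge0 ?(ltW lam_gt0).
  rewrite /weight /pr big_ord_recr/= -/(pr P) exprS le_eqVlt; apply/orP; left.
  by apply/eqP; ring.
apply: (@le_of_geometric _ _ _ (B + B) r) => [|P]; first exact: invr_itv01.
apply: le_trans (dP P) _; apply: lerD.
  rewrite [leRHS](_ : _ = G (~~ i) * D * (N i / (G i * N (~~ i)))); last first.
    by rewrite [G _ * D]mulrC !mulrA.
  rewrite ler_wpM2l ?mulr_ge0 ?(ltW (G_gt0 _))// ler_pdivlMr//.
  exact: (@sum_weight_mass R lam (fun i p => E i p) (fun i p => n i p)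
    (fun i => G i) (fun i => N i) lam_gt1 block_first_measure
    block_next_measure sum_block_measure_le).
have /andP[p0 p1] := pr01 P; have /andP[x0 x1] := expr_invr_itv lam_gt1 P.
rewrite -mulrA mulrC ler_wpM2r ?(ltW x0)//.
apply: (@le_trans _ _ (d P)); first by rewrite ler_piMl ?normr_ge0.
by apply: le_trans (ler_normB _ _) _; rewrite lerD.
Qed.

(* The constants of [oscillation_le] for [i] and [~~ i] have product 1, so a bound
   on the oscillation of [h] over points agreeing to depth [n.+1], suitably
   weighted in [i], is inherited at depth [n]; uniform continuity starts the
   descent. *)
Lemma eigenfunction_switch_const i (y z : full_shift) :
  y 0%N = ~~ i -> z 0%N = ~~ i -> h (scons i y) = h (scons i z).
Proof.
have theta_gt0 j : 0 < N j * G (~~ j) by rewrite mulr_gt0// starts_measure_gt0.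
suff small d : 0 < d -> forall i (y z : full_shift),
    y 0%N = ~~ i -> z 0%N = ~~ i ->
    `|h (scons i y) - h (scons i z)| <= d * (N i * G (~~ i)).
  move=> y0 z0; apply/eqP; rewrite -subr_eq0 -normr_le0; apply/ler_addgt0Pr => d d0.
  rewrite add0r; apply: le_trans (small (d / (N i * G (~~ i))) _ _ _ _ y0 z0) _.
    by rewrite divr_gt0.
  by rewrite divfK// gt_eqF.
move=> d0.
suff [n0 dn0] : exists n0, forall i (y z : full_shift), y 0%N = ~~ i ->
    z 0%N = ~~ i -> agree n0 y z ->
    `|h (scons i y) - h (scons i z)| <= d * (N i * G (~~ i)).
  elim: n0 dn0 => [|n0 IH] dn0; first by move=> j x x' xj x'j; exact: dn0.
  apply: IH => j x x' xj x'j xx'.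
  have -> : d * (N j * G (~~ j)) =
      d * (N (~~ j) * G j) * (G (~~ j) * N j) / (G j * N (~~ j)).
    have := starts_measure_gt0 (~~ j); have := G_gt0 j => Gj Nj.
    by field; rewrite !gt_eqF.
  apply: oscillation_le => // p.
  have := dn0 (~~ j) (iter p.+1 (scons j) x) (iter p.+1 (scons j) x').
  rewrite negbK; apply=> //; elim: p => [|p IHp]; first exact: agree_scons.
  by apply: agree_leq (agree_scons j IHp).
have [k hk] := continuous_agree ch (mulr_gt0 d0 (theta_gt0 false)).
have [k' hk'] := continuous_agree ch (mulr_gt0 d0 (theta_gt0 true)).
exists (maxn k k') => j x x' xj x'j xx'; apply: ltW; case: j xj x'j => xj x'j.
  apply: hk'; apply: agree_leq (agree_scons true xx').
  by rewrite (leq_trans (leq_maxr k k')).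
apply: hk; apply: agree_leq (agree_scons false xx').
by rewrite (leq_trans (leq_maxl k k')).
Qed.

Local Notation H i p := (h (iter p.+1 (scons i) (const_seq (~~ i)))).

(** In the induction, the eigenfunction equations at [y] and at the constant tail have equal left
    sides and equal switching terms; the remaining terms agree, and [E i p] cancels. *)
Lemma eigenfunction_run i p (y : full_shift) :
  y 0%N = ~~ i -> h (iter p.+1 (scons i) y) = H i p.
Proof.
move=> y0; elim: p => [|p IH]; first exact: eigenfunction_switch_const.
apply: (mulfI (lt0r_neq0 (proj1 (andP (E_itv i p))))).
have e1 := eigenfunction_step p y0.
have e2 := @eigenfunction_step i p (const_seq (~~ i)) erefl.
rewrite IH in e1; rewrite e1 in e2.
rewrite (@eigenfunction_switch_const (~~ i) _
  (iter p.+1 (scons i) (const_seq (~~ i)))) ?negbK// in e2.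
by move/addIr : e2.
Qed.

Lemma eigenfunction_runE i p :
  lam * H i p = E i p * H i p.+1 + G (~~ i) * H (~~ i) 0%N.
Proof.
rewrite eigenfunction_step//; congr (_ + _ * _).
by apply: eigenfunction_switch_const; rewrite negbK.
Qed.

Local Notation M i := (\int[nu]_x ((starts i 1 x)%:R * h x)).

Lemma block_cylinder_mass i p :
  \int[nu]_x ((block i p.+1 x)%:R * h x) = H i p * n i p.
Proof.
rewrite -integralZ_continuous; last exact: (@block_continuous _ i p.+1).
apply: eq_Rintegral => x _; rewrite [RHS]mulrC.
case: (boolP (block i p.+1 x)) => [/blockP[z ->]|]; last by rewrite !mul0r.
by rewrite eigenfunction_run.
Qed.

Lemma cylinder_massE i P : M i = \sum_(p < P) H i p * n i p +
  \int[nu]_x ((starts i P.+1 x)%:R * h x).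
Proof.
rewrite (integral_starts_block nu i P ch); congr (_ + _).
by apply: eq_bigr => p _; exact: block_cylinder_mass.
Qed.

Lemma sum_cylinder_mass_le i P : \sum_(p < P) H i p * n i p <= M i.
Proof.
by rewrite (cylinder_massE i P) lerDl; apply: Rintegral_ge0 => x _;
  rewrite mulr_ge0// ltW.
Qed.

Lemma cylinder_mass_tail B i P : (forall x, h x <= B) ->
  M i <= \sum_(p < P) H i p * n i p + B * r ^+ P * N i.
Proof.
move=> hB; rewrite (cylinder_massE i P) lerD2l -mulrA.
have B0 : 0 <= B by exact: le_trans (ltW (h_gt0 point)) (hB point).
apply: (le_trans _ (ler_wpM2l B0 (tail_measure i P))).
rewrite -integralZ_continuous; last exact: (@starts_continuous _ i P.+1).
apply: le_integral_continuous => [x|x|x].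
- by apply: cvgM; [exact: (@starts_continuous _ i P.+1)|exact: ch].
- by apply: cvgMr; exact: (@starts_continuous _ i P.+1).
- by rewrite mulrC ler_wpM2r.
Qed.

End eigendata.

(** * Gibbs states at low temperature *)

(** Interface between measure theory and asymptotics: the eigenfunction and the eigenmeasure
    disappear, leaving only [lam], the masses and the bounds on the partial products. A single [k]
    serves both symbols. *)
Lemma gibbs_state_bounds (R : realType) (f : full_shift -> R)
    (e : bool -> nat -> R) (g : bool -> R) (t : R)
    (mu : probability full_shift R) (k : nat) (s : bool -> R) (l : R)
    (f_run : forall i p (y : full_shift), y 0%N = ~~ i ->
      f (scons i (iter p.+1 (scons i) y)) = e i p)
    (f_switch : forall i (x : full_shift), x 0%N = ~~ i -> f (scons i x) = g i)
    (f_const : forall i, f (const_seq i) = 0)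
    (e_lt0 : forall i p, e i p < 0) (g_lt0 : forall i, g i < 0) (t_gt0 : 0 < t)
    (s_ge0 : forall i, 0 <= s i) (l_ge0 : 0 <= l)
    (prod_le : forall i p, \prod_(j < p) expR (t * e i j) <= (p < k)%:R + s i)
    (prod_ge : forall p, l <= \prod_(j < p) expR (t * e true j))
    (m := fun i => fine (mu (cylinder [:: i])))
    (G := expR (t * g false) * expR (t * g true)) :
  gibbs_state f t mu ->
  exists2 lam : R, 1 < lam <= 2 &
    [/\ l * G <= lam * (lam - 1),
        1 <= G * (k%:R + s false / (lam - 1)) * (k%:R + s true / (lam - 1)),
        0 < m false /\ 0 < m true,
        m false * (l * G) <=
          (2 * k%:R ^+ 2 * (lam - 1) ^+ 2 + 4 * s false) * m true &
        forall p, fine (mu [set x | block true p.+1 x]) <=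
          lam * (k%:R + s false / (lam - 1)) * m false].
Proof.
move=> [h [nu [[ch h_gt0 h_eigen] nu_eigen _ h_nu muE]]].
set lam := ruelle_eigenvalue f t in h_eigen nu_eigen.
have lam_gt1 : 1 < lam by exact: eigenvalue_gt1 f_const h_gt0 h_eigen.
pose E i p := expR (t * e i p); pose Gi i := expR (t * g i).
pose N i := \int[nu]_x (starts i 1 x)%:R.
pose n i p := \int[nu]_x (block i p.+1 x)%:R.
pose H i p := h (iter p.+1 (scons i) (const_seq (~~ i))).
have mass A (b : full_shift -> bool) : A = [set x | b x] -> measurable A ->
    fine (mu A) = \int[nu]_x ((b x)%:R * h x).
  move=> Ab mA; rewrite muE// -[LHS]/(Rintegral nu A h) Rintegral_mkcond.
  apply: eq_Rintegral => x _; rewrite patchE Ab; case: ifPn => /=.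
    by rewrite inE/= => ->; rewrite mul1r.
  by rewrite notin_setE/= => /negP/negbTE ->; rewrite mul0r.
have mE i : m i = \int[nu]_x ((starts i 1 x)%:R * h x).
  apply: mass; first exact: (cylinder_starts i 1).
  rewrite (cylinder_starts i 1); apply: (@measurable_continuous_indicator R).
  exact: starts_continuous.
have bE p : fine (mu [set x | block true p.+1 x]) = H true p * n true p.
  rewrite (@mass _ (block true p.+1) erefl); last first.
    apply: (@measurable_continuous_indicator R); exact: block_continuous.
  exact: (block_cylinder_mass f_run f_switch f_const e_lt0 t_gt0 ch
    h_gt0 h_eigen nu_eigen h_nu).
have E_itv i p : 0 < E i p <= 1.
  by rewrite expR_gt0/= -[leRHS]expR0 ler_expR pmulr_rle0// ltW.
have G_gt0 i : 0 < Gi i by exact: expR_gt0.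
have G_le1 : Gi false * Gi true <= 1.
  rewrite -expRD -mulrDr -[leRHS]expR0 ler_expR pmulr_rle0//.
  by have := g_lt0 false; have := g_lt0 true; lra.
have N_gt0 i : 0 < N i.
  exact: (starts_measure_gt0 f_switch f_const ch h_gt0 h_eigen nu_eigen h_nu).
have n0 i : lam * n i 0%N = Gi i * N (~~ i).
  exact: (block_first_measure f_switch nu_eigen).
have nS i p : lam * n i p.+1 = E i p * n i p.
  exact: (block_next_measure f_run nu_eigen).
have N_ge i P : \sum_(p < P) n i p <= N i by exact: (sum_block_measure_le nu i P).
have N_le i P : N i <= \sum_(p < P) n i p + lam^-1 ^+ P * N i.
  exact: (starts_measure_le f_run f_switch f_const e_lt0 t_gt0 ch
    h_gt0 h_eigen nu_eigen).
have [B B0 hB] := continuous_bounded ch.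
have h_le x : h x <= B by exact: le_trans (ler_norm _) (hB x).
have H_itv i p : 0 < H i p <= B by rewrite h_gt0 h_le.
have HS i p : lam * H i p = E i p * H i p.+1 + Gi (~~ i) * H (~~ i) 0%N.
  exact: (eigenfunction_runE f_run f_switch f_const e_lt0 t_gt0 ch
    h_gt0 h_eigen nu_eigen h_nu).
have M_ge i P : \sum_(p < P) H i p * n i p <= m i.
  by rewrite mE; exact: (sum_cylinder_mass_le f_run f_switch f_const e_lt0 t_gt0 ch
    h_gt0 h_eigen nu_eigen h_nu).
have M_le i P : m i <= \sum_(p < P) H i p * n i p + B * lam^-1 ^+ P * N i.
  by rewrite mE; exact: (cylinder_mass_tail f_run f_switch f_const e_lt0 t_gt0 ch
    h_gt0 h_eigen nu_eigen h_nu).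
exists lam.
  rewrite lam_gt1 /=.
  exact: (eigenvalue_le2 lam_gt1 G_gt0 G_le1 E_itv N_gt0 n0 nS N_le).
have m_gt0 := cylinder_mass_gt0 lam_gt1 G_gt0 E_itv N_gt0 n0 nS H_itv M_ge.
split => //.
- exact: (eigenvalue_ge lam_gt1 G_gt0 N_gt0 n0 nS N_ge l_ge0 prod_ge).
- exact: (return_le lam_gt1 G_gt0 N_gt0 n0 nS N_le s_ge0 prod_le).
- exact: (cylinder_ratio_le lam_gt1 G_gt0 G_le1 E_itv N_gt0 n0 nS N_ge N_le
    H_itv HS M_ge M_le (s_ge0 false) l_ge0 (prod_le false) prod_ge).
- move=> p; rewrite bE.
  exact: (cylinder_first_le lam_gt1 G_gt0 E_itv N_gt0 n0 nS N_le
    H_itv HS M_ge p (s_ge0 false) (prod_le false)).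
Qed.

Lemma prod_expR (R : realType) (t : R) (u : nat -> R) p :
  \prod_(j < p) expR (t * u j) = expR (t * \sum_(j < p) u j).
Proof. by rewrite mulr_sumr expR_sum. Qed.

Lemma partial_sum_bounds (R : realType) (u : nat -> R) (S d : R) :
  (forall j, u j < 0) -> (fun p : nat => \sum_(j < p) u j) @ \oo --> S ->
  0 < d ->
  (forall p, S <= \sum_(j < p) u j <= 0) /\
  exists k, forall p, (k <= p)%N -> \sum_(j < p) u j <= S + d.
Proof.
move=> u0 uS d0; split.
  move=> p; apply/andP; split; last by apply: sumr_le0 => j _; exact: ltW.
  rewrite -(cvg_lim _ uS)//;
  apply: nonincreasing_cvgn_ge; last by apply/cvg_ex; exists S.
  apply/nonincreasing_seqP => q.
  by rewrite big_ord_recr/= gerDl ltW.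
move/cvgrPdist_le : uS => /(_ _ d0)[k _ kP].
exists k => p /kP /=; rewrite distrC => /(le_trans (ler_norm _)); lra.
Qed.

Lemma gibbs_state_decay (R : realType) (f : full_shift -> R)
    (e : bool -> nat -> R) (g S : bool -> R)
    (mu : R -> probability full_shift R)
    (f_run : forall i p (y : full_shift), y 0%N = ~~ i ->
      f (scons i (iter p.+1 (scons i) y)) = e i p)
    (f_switch : forall i (x : full_shift), x 0%N = ~~ i -> f (scons i x) = g i)
    (f_const : forall i, f (const_seq i) = 0)
    (e_lt0 : forall i p, e i p < 0) (g_lt0 : forall i, g i < 0)
    (e_sum : forall i, (fun p : nat => \sum_(j < p) e i j) @ \oo --> S i)
    (S_lt : S false < g false + g true + S true)
    (mu_gibbs : forall t, 0 < t -> gibbs_state f t (mu t))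
    (m := fun t i => fine (mu t (cylinder [:: i]))) :
  exists C d T : R, [/\ 1 <= C, 0 < d, 0 < T & forall t, T <= t ->
    [/\ 0 < m t false, 0 < m t true,
        m t false <= C * expR (- (d * t)) * m t true &
        forall p, fine (mu t [set x | block true p.+1 x]) <= C * m t false]].
Proof.
pose kap := - (g false + g true).
have kap0 : 0 < kap by rewrite /kap; have := g_lt0 false; have := g_lt0 true; lra.
have S0 : S true <= 0.
  have [/(_ 0%N)] := partial_sum_bounds (e_lt0 true) (e_sum true) ltr01.
  by rewrite big_ord0 => /andP[].
(* The two right-hand sides are the competing decay rates, positive by [S_lt] and by
   [S true <= 0 < kap]. The losses below amount to at most [2 * d], which leaves the rate
   [2 * d]. *)
have [d [d0 d1 d2]] : exists d, [/\ 0 < d, 4 * d <= S true - kap - S false &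
    4 * d <= kap - S true].
  exists (Num.min (S true - kap - S false) (kap - S true) / 4).
  rewrite !(mulrC 4) divfK//; split.
  - rewrite divr_gt0// lt_min; apply/andP; split; last by lra.
    by rewrite /kap; lra.
  - by rewrite ge_min lexx.
  - by rewrite ge_min lexx orbT.
have [Sb [k0 k0P]] := partial_sum_bounds (e_lt0 false) (e_sum false) d0.
have [Sb' [k1 k1P]] := partial_sum_bounds (e_lt0 true) (e_sum true) d0.
pose k := maxn k0 k1; pose K : R := k%:R.
have K0 : 0 <= K by [].
pose C := 8 * K ^+ 2 * (K + 2) ^+ 2 + 4 + 2 * (K + 2).
have Q0 : 0 <= 8 * K ^+ 2 * (K + 2) ^+ 2.
  by apply: mulr_ge0; rewrite ?sqr_ge0// mulr_ge0// sqr_ge0.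
have C1 : 1 <= C.
  by rewrite /C; lra.
(* The second threshold makes [G * (K + 2) * K] at most 1/2, through [G * (t * kap) <= 1]; see
   [GK]. *)
exists C, (2 * d), (Num.max 1 (2 * K * (K + 2) / kap)); split => //.
- by rewrite mulr_gt0.
- by rewrite lt_max ltr01.
move=> t; rewrite ge_max => /andP[t1 tK].
have t0 : 0 < t by exact: lt_le_trans t1.
pose s i := expR (t * (S i + d)); pose l := expR (t * S true).
have s0 i : 0 <= s i by exact: expR_ge0.
have l0 : 0 <= l by exact: expR_ge0.
have prod_le i p : \prod_(j < p) expR (t * e i j) <= (p < k)%:R + s i.
  rewrite prod_expR; case: (ltnP p k) => pk.
    rewrite -[leLHS]addr0 lerD// -expR0 ler_expR pmulr_rle0//.
    by case: i; [have /andP[] := Sb' p|have /andP[] := Sb p].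
  rewrite add0r ler_expR ler_pM2l//.
  move: pk; rewrite geq_max => /andP[pk0 pk1].
  by case: i; [exact: k1P|exact: k0P].
have prod_ge p : l <= \prod_(j < p) expR (t * e true j).
  by rewrite prod_expR ler_expR ler_pM2l//; have /andP[] := Sb' p.
have := gibbs_state_bounds f_run f_switch f_const e_lt0 g_lt0 t0 s0 l0 prod_le
  prod_ge (mu_gibbs t t0).
rewrite -expRD -mulrDr -(opprK (g false + _)) -/kap.
set G := expR (t * - kap); rewrite -/(m t) -/K.
move=> [lam /andP[lam1 lam2] [lG ret [m0 m1] ratio first]].
(* [x] is the order of magnitude of [lam - 1]: [x <= 2 * (lam - 1)] by [x_le] and
   [lam - 1 <= C * x * expR (d * t)] by [eps_le]. *)
set x := l * G in lG ratio.
pose eps := lam - 1; rewrite -/eps in lG ret ratio first.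
have eps0 : 0 < eps by rewrite subr_gt0.
have x0 : 0 < x by rewrite mulr_gt0 ?expR_gt0.
have xE : x = expR (t * (S true - kap)) by rewrite /x -expRD -mulrDr.
have x_le : x <= 2 * eps.
  by apply: (le_trans lG); rewrite ler_wpM2r// ltW.
have s_x : s false / x <= expR (- (2 * d * t)).
  rewrite xE -expRN -expRD ler_expR -mulrBr mulrC -mulNr ler_pM2r//; lra.
have s_x1 : s false / x <= 1.
  apply: le_trans s_x _; rewrite -[leRHS]expR0 ler_expR oppr_le0.
  by rewrite !mulr_ge0 ?(ltW d0) ?(ltW t0).
have s_eps : s false / eps <= 2.
  rewrite ler_pdivrMr//; apply: (@le_trans _ _ x) => //.
  by move: s_x1; rewrite ler_pdivrMr// mul1r.
have A_le : K + s false / eps <= K + 2 by rewrite lerD2l.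
have A_ge : 0 <= K + s false / eps by rewrite addr_ge0// divr_ge0// ltW.
have G0 : 0 < G by exact: expR_gt0.
have GK : G * (K + 2) * K <= 2^-1.
  have G1 : G * (t * kap) <= 1.
    apply: (@le_trans _ _ (G * expR (t * kap))).
      by rewrite ler_wpM2l ?(ltW G0)//; have := expR_ge1Dx (t * kap); lra.
    by rewrite /G -expRD mulrN addNr expR0.
  move: tK; rewrite ler_pdivrMr// => tK.
  have : G * (2 * K * (K + 2)) <= 1 by apply: le_trans G1; rewrite ler_pM2l.
  by move=> GKK; nra.
(* This is [ret] multiplied by [eps]: the term in [K * eps] is at most [eps / 2] by [GK] and is
   absorbed on the left. *)
have eps_le : eps <= 2 * (K + 2) * (G * s true).
  have e1 : eps <= G * (K + 2) * (K * eps + s true).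
    have : eps <= eps * (G * (K + s false / eps) * (K + s true / eps)).
      by rewrite ler_pMr.
    move=> /le_trans; apply.
    rewrite [leLHS](_ : _ =
      G * (K + s false / eps) * (K * eps + s true)); last first.
      by field; rewrite gt_eqF.
    rewrite ler_wpM2r ?addr_ge0 ?mulr_ge0 ?(ltW eps0)//.
    by rewrite ler_wpM2l// ltW.
  have e2 : G * (K + 2) * K * eps <= 2^-1 * eps by rewrite ler_wpM2r// ltW.
  by move: e1; rewrite mulrDr mulrA; lra.
(* Since [eps] is at most of order [G * s true], the exponent is at most
   [t * (S true - kap + 2 * d)], where [4 * d <= kap - S true]. *)
have eps_x : eps ^+ 2 / x <= 4 * (K + 2) ^+ 2 * expR (- (2 * d * t)).
  apply: (@le_trans _ _ ((2 * (K + 2) * (G * s true)) ^+ 2 / x)).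
    rewrite ler_wpM2r ?invr_ge0 ?(ltW x0)// lerXn2r// nnegrE ?(ltW eps0)//.
    exact: le_trans (ltW eps0) eps_le.
  rewrite [leLHS](_ : _ = 4 * (K + 2) ^+ 2 * ((G * s true) ^+ 2 / x)); last first.
    by field; rewrite gt_eqF.
  rewrite ler_wpM2l//; first by rewrite mulr_ge0// sqr_ge0.
  rewrite xE -expRN expr2 /G /s -!expRD ler_expR.
  rewrite [leLHS](_ : _ = t * (S true - kap + 2 * d)); last by ring.
  by rewrite mulrC -mulNr ler_pM2r//; lra.
split => //.
- move: ratio; rewrite -ler_pdivlMr// => /le_trans; apply.
  rewrite mulrAC ler_wpM2r ?(ltW m1)//.
  rewrite mulrDl.
  apply: (@le_trans _ _ (2 * K ^+ 2 * (4 * (K + 2) ^+ 2 * expR (- (2 * d * t))) +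
      4 * expR (- (2 * d * t)))).
    rewrite -[_ * eps ^+ 2 / x]mulrA -[4 * _ / x]mulrA; apply: lerD.
      by apply: ler_wpM2l => //; rewrite mulr_ge0// sqr_ge0.
    exact: ler_wpM2l.
  have E0 := expR_ge0 (- (2 * d * t)).
  have : 0 <= 2 * (K + 2) * expR (- (2 * d * t)) by rewrite !mulr_ge0// addr_ge0.
  rewrite /C; lra.
- move=> p; apply: (le_trans (first p)); rewrite ler_wpM2r ?(ltW m0)//.
  apply: (@le_trans _ _ (2 * (K + 2))).
    by apply: ler_pM => //; rewrite ltW// (lt_trans _ lam1).
  by rewrite /C; lra.
Qed.

(** * Exponential rates as t tends to infinity *)

Lemma expR_decay (R : realType) (C d x : R) : 0 <= C -> 0 < d -> 0 < x ->
  \forall t \near +oo, C * expR (- (d * t)) < x.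
Proof.
move=> C0 d0 x0; near=> t.
have t0 : 0 < t by near: t; apply: nbhs_pinfty_gt; rewrite num_real.
rewrite expRN ltr_pdivrMr ?expR_gt0//.
apply: (@lt_le_trans _ _ (x * (1 + d * t))); last first.
  by rewrite ler_wpM2l ?(ltW x0)// expR_ge1Dx.
have : C / (x * d) < t by near: t; apply: nbhs_pinfty_gt; rewrite num_real.
by rewrite ltr_pdivrMr ?mulr_gt0//; lra.
Unshelve. all: by end_near. Qed.

Lemma limf_esup_pinfty_le (R : realType) (u : R -> \bar R) (x : \bar R) :
  (\forall t \near +oo%R, (u t <= x)%E) -> (limf_esup u (pinfty_nbhs R) <= x)%E.
Proof.
move=> ux; rewrite limf_esupE.
apply: ge_ereal_inf; exists (ereal_sup (u @` [set t | (u t <= x)%E])).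
  by exists [set t | (u t <= x)%E].
by apply: ge_ereal_sup => _ [t /= utx <-].
Qed.

Lemma limf_esup_log_lt0 (R : realType) (u : R -> R) (C d : R) : 1 <= C -> 0 < d ->
  (\forall t \near +oo, 0 < u t <= C * expR (- (d * t))) ->
  (limf_esup (fun t : R => (t^-1 * ln (u t))%:E) (pinfty_nbhs R) < 0)%E.
Proof.
(* Half of the rate is given up to absorb [ln C / t]. *)
move=> C1 d0 ub; apply: (@le_lt_trans _ _ (- (d / 2))%:E); last first.
  by rewrite lte_fin oppr_lt0 divr_gt0.
apply: limf_esup_pinfty_le; near=> t.
have t0 : 0 < t by near: t; apply: nbhs_pinfty_gt; rewrite num_real.
have /andP[u0 uC] : 0 < u t <= C * expR (- (d * t)) by near: t.
have tC : ln C / (d / 2) < t by near: t; apply: nbhs_pinfty_gt; rewrite num_real.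
have C0 : 0 < C by exact: lt_le_trans C1.
rewrite lee_fin mulrC ler_pdivrMr//.
apply: (@le_trans _ _ (ln C - d * t)).
  rewrite -[X in _ - X]opprK -[X in _ - - X]expRK opprK -lnM ?posrE ?expR_gt0//.
  by rewrite ler_ln ?posrE ?mulr_gt0 ?expR_gt0.
by move: tC; rewrite ltr_pdivrMr ?divr_gt0//; lra.
Unshelve. all: by end_near. Qed.


(** * Concentration on long runs of 1 *)

Section concentration.
Variables (R : realType) (rho : probability full_shift R).
Local Notation I w := (\int[rho]_x w x).

Let integral_constant (r : R) : I (fun=> r) = r.
Proof.
rewrite Rintegral_cst// -[RHS]mulr1; congr (_ * _).
exact: (congr1 fine (probability_setT rho)).
Qed.

Lemma probability_cylinder1 :
  fine (rho (cylinder [:: false])) + fine (rho (cylinder [:: true])) = 1.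
Proof.
rewrite (cylinder_starts false 1) (cylinder_starts true 1).
rewrite -!(@integral_indicator _ rho); try exact: starts_continuous.
rewrite -integralD_continuous; try exact: starts_continuous.
rewrite -[RHS](integral_constant 1); apply: eq_Rintegral => x _.
by rewrite /= !andbT; case: (x 0%N); rewrite /= ?addr0 ?add0r.
Qed.

(** Off [[1^(P+1)]] the distance to [g y] is at most [2 * B]; this complement is the disjoint union
    of [[0]] and the cylinders [[1^(p+1) 0]] with [p < P]. *)
Lemma integral_concentration (g : full_shift -> R) (B e : R) (y : full_shift) P :
  continuous g -> (forall x, `|g x| <= B) ->
  (forall x, starts true P.+1 x -> `|g x - g y| <= e) -> 0 <= e ->
  `|I g - g y| <= e + 2 * B * (fine (rho (cylinder [:: false])) +
     \sum_(p < P) fine (rho [set x | block true p.+1 x])).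
Proof.
move=> cg gB ge e0.
have B0 : 0 <= B by exact: le_trans (gB point).
have defect : fine (rho (cylinder [:: false])) +
    \sum_(p < P) fine (rho [set x | block true p.+1 x]) =
    1 - I (fun x => (starts true P.+1 x)%:R).
  have blockI p : fine (rho [set x | block true p.+1 x]) =
      I (fun x => (block true p.+1 x)%:R).
    by rewrite integral_indicator//; exact: (@block_continuous _ true p.+1).
  have startsI : fine (rho (cylinder [:: true])) = I (fun x => (starts true 1 x)%:R).
    rewrite (cylinder_starts true 1) integral_indicator//.
    exact: (@starts_continuous _ true 1).
  under eq_bigr do rewrite blockI.
  apply/eqP; rewrite eq_sym subr_eq -addrA -[eqbLHS]probability_cylinder1 startsI.
  by rewrite (starts_measureE rho true P).
rewrite defect.
have bound (r k : R) : I (fun x => r + k * (starts true P.+1 x)%:R) =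
    r + k * I (fun x => (starts true P.+1 x)%:R).
  have ck : continuous (fun x => k * (starts true P.+1 x)%:R).
    by move=> x; apply: cvgMr; exact: (@starts_continuous _ true P.+1).
  have cr : continuous ((fun=> r) : full_shift -> R) by exact: cst_continuous.
  rewrite (integralD_continuous rho cr ck) integral_constant integralZ_continuous//.
  exact: (@starts_continuous _ true P.+1).
have cont (r k : R) : continuous (fun x => r + k * (starts true P.+1 x)%:R).
  move=> x; apply: cvgD; first exact: cvg_cst.
  by apply: cvgMr; exact: (@starts_continuous _ true P.+1).
have dist x : `|g x - g y| <= e + 2 * B - 2 * B * (starts true P.+1 x)%:R.
  case: (boolP (starts true P.+1 x)) => [/ge|_].
    by rewrite mulr1 addrK.
  rewrite mulr0 subr0; apply: le_trans (ler_normB _ _) _.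
  by have := gB x; have := gB y; lra.
rewrite ler_norml; apply/andP; split.
  have : I (fun x => g y - e - 2 * B + 2 * B * (starts true P.+1 x)%:R) <= I g.
    apply: le_integral_continuous => // x.
    by have := dist x; rewrite ler_norml => /andP[]; lra.
  by rewrite bound; lra.
have : I g <= I (fun x => g y + e + 2 * B + (- (2 * B)) * (starts true P.+1 x)%:R).
  apply: le_integral_continuous => // x.
  by have := dist x; rewrite ler_norml => /andP[]; lra.
by rewrite bound; lra.
Qed.

End concentration.

Lemma Rintegral_dirac_continuous (R : realType) (y : full_shift)
  (g : full_shift -> R) :
  continuous g -> \int[\d_y]_x g x = g y.
Proof.
move=> cg; rewrite /Rintegral integral_dirac//.
  by rewrite diracT mul1e.
by apply/measurable_realfun.measurable_EFinP; exact: continuous_measurable.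
Qed.

(** * Weak-star limit and logarithmic rate of the mass ratio *)

Theorem theorem3 (R : realType) (f : full_shift -> R)
    (a : nat -> R) (la : R) (b : nat -> R) (lb : R)
    (c : nat -> R) (lc : R) (d : nat -> R) (ld : R)
    (mu : R -> probability full_shift R)
    (f_walters : walters_summable f a la b lb c lc d ld)
    (la0 : la = 0) (lc0 : lc = 0)
    (b_const : forall n, (1 <= n)%N -> b n = lb)
    (d_const : forall n, (1 <= n)%N -> d n = ld)
    (lb_lt0 : lb < 0) (ld_lt0 : ld < 0)
    (a_lt0 : forall n, (2 <= n)%N -> a n < 0)
    (c_lt0 : forall n, (2 <= n)%N -> c n < 0)
    (sum_lt : limn (fun N => \sum_(2 <= j < N) a j) <
              lb + ld + limn (fun N => \sum_(2 <= j < N) c j))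
    (mu_gibbs : forall t, 0 < t -> gibbs_state f t (mu t)) :
  weak_star_cvg mu \d_(const_seq true) /\
  (limf_esup (fun t : R => (t^-1 * ln (fine (mu t (cylinder [:: false])) /
                                       fine (mu t (cylinder [:: true]))))%:E)
             (pinfty_nbhs R) < 0)%E.
Proof.
have [[_ fac fbd [fla flb flc fld]] suma sumc] := f_walters.
(* The sequences [a] and [c] start at run length 2, hence the shift; [g i] is the value on
   [[i (~~ i)]], so [b] for the symbol 0 and [d] for the symbol 1. *)
pose e (i : bool) p := if i then c p.+2 else a p.+2.
pose g (i : bool) := if i then ld else lb.
pose S (i : bool) := if i then limn (fun N => \sum_(2 <= j < N) c j)
  else limn (fun N => \sum_(2 <= j < N) a j).
have f_run i p (y : full_shift) : y 0%N = ~~ i ->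
    f (scons i (iter p.+1 (scons i) y)) = e i p.
  move=> y0; rewrite -(scons_shift y) y0 -iterS -prepend_run /e.
  by have [] := fac (shift y) p.+2 isT; case: i {y0}.
have f_const i : f (const_seq i) = 0 by case: i; rewrite ?fla ?flc.
have f_switch i (x : full_shift) : x 0%N = ~~ i -> f (scons i x) = g i.
  case: (runP (~~ i) x) => [->|[[|q] [z ->]]] x0.
  - by rewrite -[X in scons i X]prepend_nil -prepend_cons; case: i {x0}.
  - by move: x0 => /=; case: i.
  - rewrite -prepend_run -prepend_cons negbK /g.
    have [] := fbd z q.+1 isT; rewrite b_const// d_const//.
    by case: i {x0}.
have e_lt0 i p : e i p < 0 by case: i; [exact: c_lt0|exact: a_lt0].
have g_lt0 i : g i < 0 by case: i.
have e_sum i : (fun p : nat => \sum_(j < p) e i j) @ \oo --> S i.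
  have shiftsum (u : nat -> R) : cvgn (fun N => \sum_(2 <= n < N) u n) ->
      (fun p : nat => \sum_(j < p) u j.+2) @ \oo -->
        limn (fun N => \sum_(2 <= n < N) u n).
    move=> cu; rewrite (_ : (fun p => _) = (fun p => \sum_(2 <= n < p + 2) u n)).
      by move: cu; rewrite -(cvg_shiftn 2).
    apply/funext => p; rewrite -{1}[2%N]add0n big_addn addnK big_mkord.
    by apply: eq_bigr => j _; rewrite addn2.
  have subr_sum (u : nat -> R) l : l = 0 ->
      cvgn (fun N => \sum_(2 <= n < N) (u n - l)) ->
      cvgn (fun N => \sum_(2 <= n < N) u n).
    move=> ->; rewrite (_ : (fun N => _) = (fun N => \sum_(2 <= n < N) u n))//.
    by apply/funext => N; apply: eq_bigr => n _; rewrite subr0.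
  by case: i; [exact: (shiftsum c (subr_sum c lc lc0 sumc))|
    exact: (shiftsum a (subr_sum a la la0 suma))].
have := gibbs_state_decay f_run f_switch f_const e_lt0 g_lt0 e_sum sum_lt mu_gibbs.
move=> [C [r [T [C1 r0 T0 decay]]]]; split; last first.
  apply: (limf_esup_log_lt0 C1 r0); near=> t.
  have Tt : T <= t by near: t; apply: nbhs_pinfty_ge; rewrite num_real.
  have [m0 m1 ratio _] := decay t Tt.
  by rewrite divr_gt0//= ler_pdivrMr.
move=> w cw; rewrite Rintegral_dirac_continuous//.
have [B B0 wB] := continuous_bounded cw.
apply/cvgrPdist_lt => x x0.
have [P wP] := continuous_agree cw (divr_gt0 x0 (ltr0Sn R 1)).
(* The mass off [[1^(P+1)]] is at most [1 + P * C] times that of [[0]], itself at most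
   [C * expR (- (r * t))]. *)
pose K := 2 * B * ((1 + P%:R * C) * C).
have K0 : 0 <= K.
  by rewrite !mulr_ge0 ?addr_ge0 ?mulr_ge0 ?(ltW B0)// (le_trans _ C1).
near=> t.
have Tt : T <= t by near: t; apply: nbhs_pinfty_ge; rewrite num_real.
have [m0 m1 ratio block_le] := decay t Tt.
rewrite distrC.
have small : K * expR (- (r * t)) < x / 2.
  by near: t; apply: (expR_decay K0 r0); rewrite divr_gt0.
apply: (le_lt_trans (integral_concentration (e := x / 2) (P := P) (mu t) cw wB _ _)).
- move=> y yP; apply: ltW; apply: wP => j jP.
  have : cylinder (nseq P.+1 true) y by rewrite cylinder_starts.
  by move=> /(_ j); rewrite size_nseq nth_nseq ltnS ltnW// => ->.
- by rewrite divr_ge0// ltW.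
rewrite [ltRHS](splitr x) ltrD2l; apply: le_lt_trans small.
have m_le1 : fine (mu t (cylinder [:: true])) <= 1.
  by rewrite -(probability_cylinder1 (mu t)) lerDr ltW.
have m_le : fine (mu t (cylinder [:: false])) <= C * expR (- (r * t)).
  apply: (le_trans ratio); rewrite ler_piMr// mulr_ge0 ?expR_ge0//.
  exact: le_trans C1.
rewrite /K -!mulrA ler_wpM2l// ler_wpM2l ?(ltW B0)//.
apply: (@le_trans _ _ ((1 + P%:R * C) * fine (mu t (cylinder [:: false])))).
  rewrite mulrDl mul1r lerD2l -mulrA mulr_natl -[X in _ *+ X]card_ord -sumr_const.
  by apply: ler_sum => p _; exact: block_le.
rewrite ler_wpM2l// addr_ge0// mulr_ge0//.
exact: le_trans C1.
Unshelve. all: by end_near.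
Qed.
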